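(* Let $n\in\mathbb{N}$ and let $\gamma$ be a Lie series in $\mathcal{D}$ such that $\gamma_m\in\mathcal{P}_m$ for all odd $m$. For each partition $p$ of $n$ put $\Lambda^p:=\mathcal{D}_n\gamma_p$. Then $$\mathcal{P}_n=\bigoplus_{p}\Lambda^p\qquad(p\text{ ranging over the odd partitions of }n)$$ is a decomposition of $\mathcal{P}_n$ into indecomposable $\mathcal{P}_n$-left modules. In particular, $\mathcal{P}_n$ is a direct summand of the regular $\mathcal{D}_n$-left module: $$\mathcal{D}_n=\bigoplus_{p\vdash n}\Lambda^p=\mathcal{P}_n\oplus\bigoplus_p\Lambda^p,$$ where the latter sum runs over all partitions $p$ of $n$ which are not odd.
   Context: $K$ is a field of characteristic $0$. Permutations act on the right ($i\pi$ is the image of $i$) and products in $S_n$ are read from left to right. For $\pi\in S_n$: $\mathrm{Des}(\pi)=\{1\le i\le n-1\mid i\pi>(i+1)\pi\}$, $\mathrm{Peak}(\pi)=\{2\le i\le n-1\mid (i-1)\pi<i\pi>(i+1)\pi\}$. For $D\subseteq\{1,\ldots,n-1\}$ let $\Delta^D=\sum_{\mathrm{Des}(\pi)=D}\pi$ and $\Xi^D=\sum_{E\subseteq D}\Delta^E$; $\mathcal{D}_n$ is the span of the $\Delta^D$ (a subalgebra of $KS_n$), $\mathcal{D}=\bigoplus_{n\ge0}\mathcal{D}_n$. For a word $q=q_1.\cdots.q_k$ of positive integers with sum $n$: $D(q)=\{q_1,q_1+q_2,\ldots,q_1+\cdots+q_{k-1}\}$, $\Delta^q=\Delta^{D(q)}$,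 $\Xi^q=\Xi^{D(q)}$. The outer product on $\mathcal{D}$ is $\Xi^r\star\Xi^q=\Xi^{r.q}$ (concatenation). $\mathcal{P}_n\subseteq\mathcal{D}_n$ is the span of the elements $\sum_{\mathrm{Peak}(\pi)=P}\pi$, $P\subseteq\{2,\ldots,n-1\}$; it is a left ideal of $\mathcal{D}_n$, hence an algebra (in general without identity). Let $\omega_n=\sum_{k=0}^{n-1}(-1)^k\Delta^{1^{.k}.(n-k)}$, where $1^{.k}$ is the word of $k$ letters $1$. An idempotent $\alpha\in KS_n$ is a Lie idempotent if $\alpha KS_n=\omega_nKS_n$. A Lie series in $\mathcal{D}$ is a map $\gamma:\mathbb{N}\to\mathcal{D}$, $m\mapsto\gamma_m\in\mathcal{D}_m$, such that $\frac1m\gamma_m$ is a Lie idempotent for all $m\in\mathbb{N}$; for $q=q_1.\cdots.q_k$, $\gamma_q=\gamma_{q_1}\star\cdots\star\gamma_{q_k}$. A partition $p=p_1.\cdots.p_l$ of $n$ has $p_1\ge\cdots\ge p_l$ and sum $n$; it is odd if all its parts are odd. $\Lambda^p$ is a left module under left multiplication in $KS_n$. *)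

(* Defs.v *)
From HB Require Import structures.
From mathcomp Require Import all_boot all_order all_algebra all_fingroup all_field.

Set Implicit Arguments.
Unset Strict Implicit.
Unset Printing Implicit Defensive.

Import GRing.Theory.
Local Open Scope ring_scope.

(* The carrier is an alias of {ffun gT -> K^o}: it keeps the vector space      *)
(* structure of that type, but its product is the convolution product.         *)
Definition galg (K : fieldType) (gT : finGroupType) : Type := {ffun gT -> K^o}.

Section GroupAlgebra.
Variables (K : fieldType) (gT : finGroupType).
Local Notation A := (galg K gT).
Implicit Types (f g h : A) (x y : gT).

HB.instance Definition _ := GRing.Lmodule.on A.
HB.instance Definition _ := Vector.on A.

Definition gelt x : A := [ffun y => (y == x)%:R].
Definition gmul f g : A := [ffun x => \sum_y (f y : K) * g (y^-1 * x)%g].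

Fact gmulA : associative gmul.
Proof.
move=> f g h; apply/ffunP=> x; rewrite !ffunE.
under eq_bigr do rewrite ffunE mulr_sumr.
under [RHS]eq_bigr do rewrite ffunE mulr_suml.
rewrite [RHS]exchange_big; apply: eq_bigr => y _ /=.
rewrite (reindex_inj (mulgI y^-1%g)); apply: eq_bigr => z _ /=.
by rewrite mulrA invMg invgK -!mulgA mulKVg.
Qed.

Fact gmul1l : left_id (gelt 1%g) gmul.
Proof.
move=> f; apply/ffunP=> x; rewrite ffunE (bigD1 1%g) //= big1 => [|y y1].
  by rewrite ffunE eqxx mul1r addr0 invg1 mul1g.
by rewrite ffunE (negPf y1) mul0r.
Qed.

Fact gmul1r : right_id (gelt 1%g) gmul.
Proof.
move=> f; apply/ffunP=> x; rewrite ffunE (bigD1 x) //= big1 => [|y yx].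
  by rewrite ffunE mulVg eqxx mulr1 addr0.
by rewrite ffunE -eq_mulVg1 (negPf yx) mulr0.
Qed.

Fact gmulDl : left_distributive gmul +%R.
Proof.
move=> f g h; apply/ffunP=> x; rewrite !ffunE -big_split.
by apply: eq_bigr => y _; rewrite ffunE mulrDl.
Qed.

Fact gmulDr : right_distributive gmul +%R.
Proof.
move=> f g h; apply/ffunP=> x; rewrite !ffunE -big_split.
by apply: eq_bigr => y _; rewrite ffunE mulrDr.
Qed.

Fact gone_neq0 : gelt 1%g != 0.
Proof.
apply/eqP=> /ffunP/(_ 1%g); rewrite !ffunE eqxx => /eqP.
by rewrite oner_eq0.
Qed.

HB.instance Definition _ := GRing.Zmodule_isNzRing.Build A
  gmulA gmul1l gmul1r gmulDl gmulDr gone_neq0.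

Fact gscaleAl (a : K) f g : a *: (f * g) = (a *: f) * g.
Proof.
apply/ffunP=> x; rewrite !ffunE scaler_sumr; apply: eq_bigr => y _.
by rewrite ffunE [LHS]mulrA.
Qed.

HB.instance Definition _ := GRing.Lmodule_isLalgebra.Build K A gscaleAl.

Fact gscaleAr (a : K) f g : a *: (f * g) = f * (a *: g).
Proof.
apply/ffunP=> x; rewrite !ffunE scaler_sumr; apply: eq_bigr => y _.
by rewrite ffunE [LHS]mulrCA.
Qed.

HB.instance Definition _ := GRing.Lalgebra_isAlgebra.Build K A gscaleAr.
HB.instance Definition _ := Algebra_isFalgebra.Build K A.

Lemma geltM x y : gelt (x * y)%g = gelt x * gelt y.
Proof.
apply/ffunP=> z; rewrite !ffunE (bigD1 x) //= big1 => [|t tx].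
  by rewrite !ffunE eqxx mul1r addr0 -[z in LHS](mulKVg x) (inj_eq (mulgI x)).
by rewrite ffunE (negPf tx) mul0r.
Qed.

End GroupAlgebra.

(* In 'S_n, (s * t) i = t (s i): permutations act on the right and products    *)
(* are read from left to right.                                                *)
Notation "'KS[ K ]_ n" := (galg K 'S_n)
  (at level 8, K at level 2, n at level 2, format "''KS[' K ]_ n") : type_scope.

Section DescentsAndPeaks.
Variable n : nat.
Implicit Types (s : 'S_n) (D : {set 'I_n.-1}).

Definition one_line s : seq nat := [seq val (s i) | i : 'I_n].

(* The position i of {1, ..., n-1} is encoded by the element i-1 of 'I_n.-1,   *)
(* and the position i of {2, ..., n-1} by the element i-2 of 'I_n.-2; one_line *)
(* is indexed from 0.                                                          *)
Definition Des s : {set 'I_n.-1} :=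
  [set i : 'I_n.-1 | nth 0%N (one_line s) i > nth 0%N (one_line s) i.+1]%N.

Definition Peak s : {set 'I_n.-2} :=
  [set i : 'I_n.-2 | (nth 0%N (one_line s) i < nth 0%N (one_line s) i.+1)%N
                  && (nth 0%N (one_line s) i.+1 > nth 0%N (one_line s) i.+2)%N].

(* The total sum of q is also one of the partial sums, but when it is n it is  *)
(* out of the range of 'I_n.-1.                                                *)
Definition wset (q : seq nat) : {set 'I_n.-1} :=
  [set i : 'I_n.-1 | i.+1 \in scanl addn 0%N q].

(* The composition q of n with wset q = D. *)
Definition setw D : seq nat :=
  if n is 0 then [::] else
  pairmap (fun a b => b - a)%N 0%N (rcons [seq (val i).+1 | i <- enum D] n).

End DescentsAndPeaks.

Section DescentAlgebra.
Variables (K : fieldType) (n : nat).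

Definition Delta (D : {set 'I_n.-1}) : 'KS[K]_n :=
  \sum_(s : 'S_n | Des s == D) gelt K s.

Definition Xi (D : {set 'I_n.-1}) : 'KS[K]_n :=
  \sum_(E : {set 'I_n.-1} | E \subset D) Delta E.

Definition Pi (P : {set 'I_n.-2}) : 'KS[K]_n :=
  \sum_(s : 'S_n | Peak s == P) gelt K s.

Definition descent_alg : {vspace 'KS[K]_n} :=
  <<[seq Delta D | D : {set 'I_n.-1}]>>%VS.

Definition peak_alg : {vspace 'KS[K]_n} :=
  <<[seq Pi P | P : {set 'I_n.-2}]>>%VS.

Definition Xi_basis : #|{set 'I_n.-1}|.-tuple 'KS[K]_n :=
  [tuple Xi (enum_val i) | i < #|{set 'I_n.-1}|].

Definition Xi_coord (D : {set 'I_n.-1}) (x : 'KS[K]_n) : K :=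
  coord Xi_basis (enum_rank D) x.

Definition omega : 'KS[K]_n :=
  \sum_(k < n) (-1) ^+ k *: Delta (wset n (rcons (nseq k 1%N) (n - k)%N)).

Definition lie_idempotent (a : 'KS[K]_n) : Prop :=
  a * a = a /\ (amull a @: fullv)%VS = (amull omega @: fullv)%VS.

End DescentAlgebra.

(* The bilinear extension of Xi^r * Xi^q = Xi^(r.q) on the bases of the Xi's;  *)
(* see outer_Xi. Only its values on the descent algebras are meaningful.       *)
Definition outer (K : fieldType) (m n : nat) (x : 'KS[K]_m) (y : 'KS[K]_n) :
    'KS[K]_(m + n)%N :=
  \sum_(D : {set 'I_m.-1}) \sum_(E : {set 'I_n.-1})
    (Xi_coord D x * Xi_coord E y) *: Xi K (wset (m + n) (setw D ++ setw E)).

(* A family g stands for a Lie series; its value g 0 is unconstrained and is   *)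
(* never used.                                                                 *)
Definition lie_series (K : fieldType) (g : forall m, 'KS[K]_m) : Prop :=
  forall m, (0 < m)%N ->
    g m \in descent_alg K m /\ lie_idempotent (m%:R^-1 *: g m).

(* The empty product is the unit Xi^[::] of the outer product, which is the    *)
(* unit of the group algebra of 'S_0.                                          *)
Fixpoint outer_word (K : fieldType) (g : forall m, 'KS[K]_m) (q : seq nat) :
    'KS[K]_(sumn q) :=
  match q return 'KS[K]_(sumn q) with
  | [::] => 1
  | k :: q' => outer (g k) (outer_word g q')
  end.

Definition is_partition (n : nat) (p : seq nat) : bool :=
  [&& sorted geq p, 0%N \notin p & sumn p == n].

(* A partition of n has at most n parts, all at most n, so that this finite    *)
(* type holds all of them.                                                     *)
Definition partition_of (n : nat) : Type :=
  {p : n.-bseq 'I_n.+1 | is_partition n [seq val i | i <- p]}.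
HB.instance Definition _ n := Finite.on (partition_of n).

Definition parts (n : nat) (p : partition_of n) : seq nat :=
  [seq val i | i <- val p].

Lemma sumn_parts (n : nat) (p : partition_of n) : sumn (parts p) = n.
Proof. by have /and3P[_ _ /eqP] := valP p. Qed.

Definition odd_partition (n : nat) (p : partition_of n) : bool :=
  all odd (parts p).

Definition outer_partition (K : fieldType) (g : forall m, 'KS[K]_m) (n : nat)
    (p : partition_of n) : 'KS[K]_n :=
  ecast m 'KS[K]_m (sumn_parts p) (outer_word g (parts p)).

Definition Lambda (K : fieldType) (g : forall m, 'KS[K]_m) (n : nat)
    (p : partition_of n) : {vspace 'KS[K]_n} :=
  (amulr (outer_partition g p) @: descent_alg K n)%VS.

(* The algebra A acting by left multiplication need not have an identity. *)
Definition left_module (K : fieldType) (aT : falgType K) (A M : {vspace aT}) :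
    Prop := (A * M <= M)%VS.

Definition indecomposable (K : fieldType) (aT : falgType K)
    (A M : {vspace aT}) : Prop :=
  M <> 0%VS /\
  forall U V : {vspace aT}, left_module A U -> left_module A V ->
    directv (U + V) -> (U + V)%VS = M -> U = 0%VS \/ V = 0%VS.

Lemma in_partition_of (n : nat) (q : seq nat) :
  is_partition n q -> exists p : partition_of n, parts p = q.
Proof.
move=> qP; have /and3P[_ q0 /eqP qn] := qP.
have szq : (size q <= n)%N.
  rewrite -qn -sum1_size sumnE big_seq [leqRHS]big_seq; apply: leq_sum => i iq.
  by rewrite lt0n; apply: contraNneq q0 => <-.
have leq_qn i : i \in q -> (i < n.+1)%N.
  by move=> iq; rewrite ltnS -qn sumnE (big_rem i) //= leq_addr.
pose w : seq 'I_n.+1 := [seq inord i | i <- q].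
have wq : [seq val i | i <- w] = q.
  rewrite -map_comp -[RHS]map_id; apply/eq_in_map => i iq /=.
  by rewrite inordK ?leq_qn.
have szw : (size w <= n)%N by rewrite size_map.
have wP : is_partition n [seq val i | i <- Bseq szw] by rewrite /= wq.
by exists (Sub (Bseq szw) wP).
Qed.

Lemma scanl_pairmap a (q : seq nat) : path leq a q ->
  scanl addn a (pairmap (fun a b => b - a)%N a q) = q.
Proof.
elim: q a => //= b q IHq a /andP[ab bq].
by rewrite subnKC // IHq.
Qed.

Lemma scanl_setw n (D : {set 'I_n.-1}) : (0 < n)%N ->
  scanl addn 0%N (setw D) = rcons [seq (val i).+1 | i <- enum D] n.
Proof.
case: n D => // n D _; rewrite scanl_pairmap // rcons_path.
rewrite path_min_sorted; last by apply/allP=> ? /mapP[j _ ->].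
apply/andP; split; last first.
  apply: (@leq_trans n); last by [].
  have : all (fun i => i <= n)%N (0%N :: [seq (val i).+1 | i <- enum D]).
    by rewrite /=; apply/allP=> ? /mapP[j _ ->].
  by move=> /allP/(_ _ (mem_last _ _)).
rewrite sorted_map /enum_mem; apply: sorted_filter.
  by move=> i j k; apply: leq_trans.
rewrite -enumT; have := iota_sorted 0 n.
by rewrite -val_enum_ord sorted_map.
Qed.

Lemma last_scanl_addn a (q : seq nat) : last a (scanl addn a q) = (a + sumn q)%N.
Proof. by elim: q a => [|b q IHq] a /=; rewrite ?addn0 // IHq addnA. Qed.

Lemma sumn_setw n (D : {set 'I_n.-1}) : sumn (setw D) = n.
Proof.
case: n D => // n D; have /(congr1 (fun s => last 0%N s)) := @scanl_setw n.+1 D isT.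
by rewrite last_rcons last_scanl_addn.
Qed.

Lemma setwK n : cancel (@setw n) (wset n).
Proof.
move=> D; apply/setP=> i; have n0 : (0 < n)%N by case: n i {D} => // -[].
rewrite inE scanl_setw // mem_rcons inE.
case: eqP => [eqn | _] /=.
  by have := ltn_ord i; rewrite -{2}eqn /= ltnn.
by rewrite (mem_map (f := fun i : 'I_n.-1 => (val i).+1)) ?mem_enum // => a b [/val_inj].
Qed.

Lemma scanl_shift a (q : seq nat) :
  scanl addn a q = [seq (a + b)%N | b <- scanl addn 0%N q].
Proof.
elim: q a => //= b q IHq a; rewrite add0n IHq [in RHS]IHq -map_comp.
by congr (_ :: _); apply: eq_map => c /=; rewrite addnA.
Qed.

Lemma mem_scanl_le (q : seq nat) k : k \in scanl addn 0%N q -> (k <= sumn q)%N.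
Proof.
elim: q k => //= b q IHq k; rewrite add0n inE => /predU1P[->|].
  exact: leq_addr.
by rewrite scanl_shift => /mapP[c /IHq cq ->]; rewrite leq_add2l.
Qed.

Lemma sumn_mem_scanl (q : seq nat) : (0 < sumn q)%N -> sumn q \in scanl addn 0%N q.
Proof.
case: q => // b q _; rewrite -[X in X \in _]add0n -last_scanl_addn /=.
exact: mem_last.
Qed.

Lemma mem_scanl_cat (r q : seq nat) k : (0 < k)%N ->
  (k \in scanl addn 0%N (r ++ q)) =
  if (k <= sumn r)%N then (k == sumn r) || (k \in scanl addn 0%N r)
  else (k - sumn r)%N \in scanl addn 0%N q.
Proof.
move=> k0; rewrite scanl_cat mem_cat.
have -> : foldl addn 0%N r = sumn r.
  by rewrite -[RHS]add0n; elim: r 0%N => [|b r IHr] a /=; rewrite ?addn0 // IHr addnA.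
rewrite (scanl_shift (sumn r)).
have memq : (k \in [seq (sumn r + b)%N | b <- scanl addn 0%N q]) =
    (sumn r <= k)%N && ((k - sumn r)%N \in scanl addn 0%N q).
  apply/mapP/andP => [[b bq ->] | [rk kq]]; first by rewrite leq_addr addKn.
  by exists (k - sumn r)%N; rewrite ?subnKC.
rewrite memq; case: (ltngtP k (sumn r)) => [ltk | gtk | eqk] /=.
- by rewrite orbF.
- case kr: (k \in _) => //=; have := mem_scanl_le kr.
  by rewrite leqNgt gtk.
- by rewrite eqk sumn_mem_scanl // -eqk.
Qed.

Lemma mem_wset n (q : seq nat) k : (0 < k < n)%N -> 
  (k \in scanl addn 0%N q) = (k \in [seq (val i).+1 | i <- enum (wset n q)]).
Proof.
case: k => // k /= kn; have kn' : (k < n.-1)%N by case: n kn.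
apply/idP/mapP => [kq | [i + [->]]]; last by rewrite mem_enum inE.
by exists (Ordinal kn'); rewrite // mem_enum inE.
Qed.

Lemma wset_cat m n (r r' q q' : seq nat) :
    sumn r = m -> sumn r' = m -> wset m r = wset m r' -> wset n q = wset n q' ->
  wset (m + n) (r ++ q) = wset (m + n) (r' ++ q').
Proof.
move=> rm r'm rr' qq'; apply/setP=> i; rewrite !inE !mem_scanl_cat // rm r'm.
have imn : (i.+1 < m + n)%N.
  by have := ltn_ord i; rewrite -ltnS prednK //; case: (m + n)%N i => // -[].
case: (leqP i.+1 m) => im.
  case: eqVneq => //= im'; have i0 : (0 < i.+1 < m)%N by rewrite /= ltn_neqAle im andbT.
  by rewrite !(mem_wset _ i0) rr'.
have i0 : (0 < i.+1 - m < n)%N by rewrite subn_gt0 im ltn_subLR // ltnW.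
by rewrite !(mem_wset _ i0) qq'.
Qed.

Lemma Des_surj n (D : {set 'I_n.-1}) : exists s : 'S_n, Des s = D.
Proof.
pose b (i : nat) := (\sum_(j in D) (i <= j))%N.
pose key (i : 'I_n) := (b i * n + i)%N.
have key_inj : injective key.
  move=> i j /(congr1 (modn^~ n)); rewrite /key !modnMDl !modn_small //.
  exact: val_inj.
pose rk (i : 'I_n) := #|[set j | (key j < key i)%N]|.
have rk_lt i : (rk i < n)%N.
  rewrite -[leqRHS]card_ord -cardsT; apply: proper_card; apply/properP.
  by split; [exact: subsetT | by exists i; rewrite ?inE ?ltnn].
have rk_mono i j : (key i < key j)%N -> (rk i < rk j)%N.
  move=> ij; apply: proper_card; apply/properP; split.
    by apply/subsetP => k; rewrite !inE => ki; apply: ltn_trans ij.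
  by exists i; rewrite !inE ?ltnn.
pose f i := Ordinal (rk_lt i).
have f_inj : injective f.
  move=> i j /(congr1 val) /= rij; apply: key_inj.
  by case: (ltngtP (key i) (key j)) => // /rk_mono; rewrite rij ltnn.
exists (perm f_inj); apply/setP=> i; rewrite inE.
have n0 : (0 < n)%N by case: n i {D b key key_inj rk rk_lt rk_mono f f_inj} => // -[].
have i1 : (i < n)%N by apply: leq_trans (ltn_ord i) _; apply: leq_pred.
have i2 : (i.+1 < n)%N by have := ltn_ord i; rewrite -ltnS prednK.
have nthE k (kn : (k < n)%N) : nth 0%N (one_line (perm f_inj)) k = rk (Ordinal kn).
  rewrite /one_line (nth_map (Ordinal kn)) ?size_enum_ord // permE /=.
  by congr rk; apply: val_inj; rewrite /= nth_enum_ord.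
rewrite !nthE.
have bE : b i = ((i \in D) + b i.+1)%N.
  rewrite /b; case: (boolP (i \in D)) => iD; last first.
    apply: eq_bigr => j jD; rewrite leq_eqVlt.
    by case: eqP => // /ord_inj ij; rewrite ij jD in iD.
  rewrite (bigD1 i) //= leqnn [in RHS](bigD1 i) //= ltnn add0n; congr (_ + _)%N.
  apply: eq_bigr => j /andP[_ ji]; rewrite leq_eqVlt.
  by rewrite (inj_eq val_inj) eq_sym (negPf ji).
case: (boolP (i \in D)) bE => iD bE.
  apply: rk_mono; rewrite /key /= bE add1n mulSn.
  by rewrite -addnA addnCA ltn_add2l ltn_addr.
apply/negbTE; rewrite -leqNgt ltnW //; apply: rk_mono.
by rewrite /key /= bE ltn_add2l.
Qed.

Section OuterProduct.
Variable K : fieldType.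

Lemma Xi_ffunE n (D : {set 'I_n.-1}) (s : 'S_n) :
  (Xi K D : {ffun _ -> _}) s = (Des s \subset D)%:R.
Proof.
rewrite /Xi /Delta sum_ffunE.
have dE E : (\sum_(t : 'S_n | Des t == E) gelt K t : {ffun _ -> _}) s = (Des s == E)%:R.
  rewrite sum_ffunE; case: (boolP (Des s == E)) => sE.
    rewrite (bigD1 s) //= ffunE eqxx big1 ?addr0 // => t /andP[_ ts].
    by rewrite ffunE eq_sym (negPf ts).
  by rewrite big1 // => t tE; rewrite ffunE; case: eqVneq => // st; rewrite st tE in sE.
under eq_bigr do rewrite dE.
case: (boolP (Des s \subset D)) => sD.
  rewrite (bigD1 (Des s)) //= eqxx big1 ?addr0 // => E /andP[_ Es].
  by rewrite eq_sym (negPf Es).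
by rewrite big1 // => E ED; case: eqVneq => // sE; rewrite sE ED in sD.
Qed.

Lemma nth_Xi_basis n (D : {set 'I_n.-1}) : (Xi_basis K n)`_(enum_rank D) = Xi K D.
Proof. by rewrite -tnth_nth tnth_mktuple enum_rankK. Qed.

Lemma Xi_free n : free (Xi_basis K n).
Proof.
apply/freeP => k k0.
have {}k0 (E : {set 'I_n.-1}) : \sum_(D : {set 'I_n.-1} | E \subset D) k (enum_rank D) = 0.
  have [s <-] := Des_surj E; move/ffunP/(_ s): k0; rewrite sum_ffunE [RHS]ffunE => k0s; rewrite -[RHS]k0s.
  rewrite [RHS](reindex (@enum_rank _)); last first.
    by apply: onW_bij; apply: enum_rank_bij.
  rewrite [LHS]big_mkcond; apply: eq_bigr => D _.
  rewrite nth_Xi_basis ffunE Xi_ffunE.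
  by case: ifP => _; rewrite -[RHS]/(k _ * _) ?mulr1 ?mulr0.
suff kD (D : {set 'I_n.-1}) : k (enum_rank D) = 0 by move=> i; rewrite -(enum_valK i).
have [m] := ubnP #|~: D|; elim: m D => // m IHm D Dm.
have := k0 D; rewrite (bigD1 D) //= big1 ?addr0 // => E /andP[DE ED].
apply: IHm; rewrite ltnS in Dm; apply: leq_trans Dm; apply: proper_card.
by rewrite properE !setCS DE; apply: contraNN ED => ?; rewrite eqEsubset DE andbT.
Qed.

Lemma Xi_coordE n (D E : {set 'I_n.-1}) : Xi_coord D (Xi K E) = (D == E)%:R.
Proof.
by rewrite /Xi_coord -(nth_Xi_basis E) coord_free ?Xi_free // (inj_eq enum_rank_inj) eq_sym.
Qed.

Lemma outer_Xi m n (r q : seq nat) : sumn r = m -> sumn q = n ->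
  outer (Xi K (wset m r)) (Xi K (wset n q)) = Xi K (wset (m + n) (r ++ q)).
Proof.
move=> rm qn; rewrite /outer (bigD1 (wset m r)) //= [X in _ + X]big1 => [|D Dr].
  rewrite addr0 (bigD1 (wset n q)) //= big1 => [|E Eq].
    rewrite !Xi_coordE !eqxx mulr1 scale1r addr0; congr (Xi K _).
    by apply: wset_cat; rewrite ?sumn_setw ?setwK.
  by rewrite !Xi_coordE (negPf Eq) mulr0 scale0r.
by rewrite big1 // => E _; rewrite !Xi_coordE (negPf Dr) mul0r scale0r.
Qed.

End OuterProduct.

(* Main.v *)
Require Import Defs.
From mathcomp Require Import all_boot all_order all_algebra all_fingroup all_field.
From mathcomp Require Import zify.

Set Implicit Arguments.
Unset Strict Implicit.
Unset Printing Implicit Defensive.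

Import GRing.Theory.
Local Open Scope ring_scope.

(* A function of descent sets extends from permutations to all words, and the   *)
(* outer product becomes deconcatenation: (x * y)(w) = x(w1) y(w2), where w1    *)
(* and w2 are the first m and the last n letters of w.  Left multiplication by  *)
(* Xi^r sums over the shuffles of the blocks of w of lengths r.  The element    *)
(* omega, hence each g_m, vanishes on proper shuffles; splitting a shuffle      *)
(* into its first letters and the rest then gives                               *)
(*   Xi^r g_q = the sum of g_(U_1...U_k) over all ways of distributing the      *)
(*   letters of q into words U_i of sum r_i.                                    *)
(* So this is a combination of the g_v with v a rearrangement of q; it is 0 if  *)
(* r is longer than q, and a nonzero multiple of g_r if r is a rearrangement of *)
(* q.  As (1/m) g_m is idempotent, g_q is a nonzero multiple of Xi^q plus terms *)
(* Xi^r with r finer than q.  Hence the g_q form a basis of D_n, Lambda^p has   *)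
(* the basis of all g_q with q a rearrangement of p, and g_p maps Lambda^p onto *)
(* its own span, which makes Lambda^p indecomposable.  Peak functions are       *)
(* closed under the outer product because the peaks of w determine those of w1  *)
(* and w2, so the g_q with q odd lie in P_n, and they span it because there are *)
(* at least as many odd compositions as peak sets.                              *)

(** * Sums over shuffles *)

(** The outline above is carried by the following lemmas. Reading elements of the descent algebra as
    functions on words ([lv]) turns the outer product into deconcatenation ([lv_outer]) and left
    multiplication by [Xi] into a sum over shuffles ([mulXi]). That [omega] vanishes on proper
    shuffles is [lie_omega_word]; since g_m lies in the right ideal generated by [omega], the same
    holds for the series ([lie_series_functional]). This vanishing alone yields the expansion of
    Xi^r g_q ([shsum_gw], [mulXi_gam]) and its three consequences [mulXi_gam_span], [mulXi_gam0] and
    [mulXi_gam_perm].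

    Idempotency enters only through the coefficient of the identity in g_m, which cannot be 0
    ([Xi_coord_lie_series]); it makes the passage from the Xi^q to the g_q triangular and invertible
    ([gam_triangular], [gam_spanT], [gam_free]). All sums of modules then become spans of
    subfamilies of one basis, and directness is a count of basis elements. The peak algebra contains
    the g_q with q odd ([gam_peak]) and is no larger than their span because peak sets inject into
    odd compositions ([card_peak_sets]). Indecomposability rests on [gamD_mul_gamD]. *)

Section Shuffles.
Variable k : nat.
Local Notation blocks := {ffun 'I_k -> seq nat}.
Implicit Types (B : blocks) (c : {ffun 'I_k -> nat}) (v w : seq nat).

Definition upd B i b : blocks := [ffun j => if j == i then b else B j].

Definition dropc c B : blocks := [ffun i => drop (c i) (B i)].
Definition takec c B : blocks := [ffun i => take (c i) (B i)].

Definition pop B i := upd B i (behead (B i)).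

Definition disjoint_blocks B : Prop :=
  (forall i, uniq (B i)) /\ (forall i j x, x \in B i -> x \in B j -> i = j).

Lemma disjoint_sub B B' :
  (forall i, subseq (B' i) (B i)) -> disjoint_blocks B -> disjoint_blocks B'.
Proof.
move=> sB [uB dB]; split=> [i | i j x /(mem_subseq (sB i)) xi /(mem_subseq (sB j))].
  exact: subseq_uniq (sB i) (uB i).
exact: dB.
Qed.

Lemma subseq_pop B i j : subseq (pop B i j) (B j).
Proof. by rewrite ffunE; case: eqP => // ->; rewrite -drop1 drop_subseq. Qed.

Lemma sum_size_upd B i b :
  (\sum_j size (upd B i b j) + size (B i) = \sum_j size (B j) + size b)%N.
Proof.
rewrite (bigD1 i) //= [X in _ = (X + _)%N](bigD1 i) //= ffunE eqxx.
under eq_bigr => j /negPf ji do rewrite ffunE ji.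
by rewrite addnAC [in RHS]addnAC (addnC (size b)).
Qed.

Lemma sum_size_pop B i : B i != [::] ->
  (\sum_j size (pop B i j)).+1 = (\sum_j size (B j))%N.
Proof.
case Bi: (B i) => [|x b] // _; apply: (@addIn (size b)).
by rewrite -(sum_size_upd B i b) /pop Bi /= addSnnS.
Qed.

Section Sums.
Variable R : comNzRingType.
Implicit Types (h : seq nat -> blocks -> R) (f : seq nat -> R).

(* The sum of h v B' over all ways of taking the first n letters v of a shuffle *)
(* of the blocks B, where B' is what remains of the blocks.                     *)
Fixpoint shsum n B h : R :=
  if n is n'.+1 then
    \sum_(i | B i != [::]) shsum n' (pop B i) (fun v => h (head 0%N (B i) :: v))
  else h [::] B.

Lemma dropc0 c B : (\sum_i c i = 0)%N -> dropc c B = B.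
Proof.
move/eqP; rewrite sum_nat_eq0 => /forallP c0; apply/ffunP=> i.
by rewrite ffunE (eqP (c0 i)) drop0.
Qed.

(** The recursion only removes prefixes, so what remains is always some [dropc c B]. This form and
    the bounds on [c] are handed to the user, because later proofs sort the terms by [c]. *)
Lemma eq_shsum n B h h' :
    (forall v c, size v = n -> (\sum_i c i = n)%N ->
      (forall i, c i <= size (B i))%N -> (forall x, x \in v -> exists i, x \in B i) ->
      h v (dropc c B) = h' v (dropc c B)) ->
  shsum n B h = shsum n B h'.
Proof.
elim: n B h h' => [|n IHn] B h h' hh' /=.
  have c0 : (\sum_(i : 'I_k) [ffun=> 0%N] i = 0)%N.
    by rewrite big1 // => i _; rewrite ffunE.
  rewrite -(dropc0 B c0); apply: hh' => // i; by rewrite ffunE.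
apply: eq_bigr => i Bi; apply: IHn => v c szv sumc lec memv.
pose c' : {ffun 'I_k -> nat} := [ffun j => (c j + (j == i))%N].
have -> : dropc c (pop B i) = dropc c' B.
  apply/ffunP=> j; rewrite !ffunE; case: eqP => [->|_]; last by rewrite addn0.
  by rewrite addn1 -drop1 drop_drop addn1.
apply: hh' => [||j|x].
- by rewrite /= szv.
- under eq_bigr do rewrite ffunE.
  rewrite big_split /= sumc (bigD1 i) //= eqxx big1 ?addn1 // => j /negPf->.
  by [].
- rewrite ffunE; have := lec j; rewrite ffunE; case: eqP => [->|_]; last by rewrite addn0.
  by rewrite size_behead; case: (B i) Bi => //= y b _; rewrite addn1.
rewrite inE => /predU1P[->|/memv[j]]; last by move/(mem_subseq (subseq_pop _ _ _)); exists j.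
by exists i; case: (B i) Bi => //= y b _; rewrite mem_head.
Qed.

Lemma shsum0 n B : shsum n B (fun _ _ => 0) = 0.
Proof. by elim: n B => //= n IHn B; apply: big1. Qed.

Lemma shsumM n B h a : shsum n B (fun v B' => a * h v B') = a * shsum n B h.
Proof.
elim: n B h => //= n IHn B h; rewrite mulr_sumr; apply: eq_bigr => i _.
exact: IHn.
Qed.

Lemma shsum_sum n B (I : finType) (P : pred I) (h : I -> seq nat -> blocks -> R) :
  shsum n B (fun v B' => \sum_(i | P i) h i v B') = \sum_(i | P i) shsum n B (h i).
Proof.
elim: n B h => //= n IHn B h; rewrite exchange_big /=; apply: eq_bigr => i _.
exact: IHn.
Qed.

Lemma shsum_cat a b B h :
  shsum (a + b) B h = shsum a B (fun v B' => shsum b B' (fun v' => h (v ++ v'))).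
Proof. by elim: a B h => //= a IHa B h; apply: eq_bigr => i _; apply: IHa. Qed.

(** Prescribing the remainder fixes how many letters each block gives away, so only the prefixes of
    these lengths matter. *)
Lemma shsum_take n B c f :
    (forall i, c i <= size (B i))%N -> (\sum_i c i = n)%N ->
  shsum n B (fun v B' => f v * (B' == dropc c B)%:R) =
    shsum n (takec c B) (fun v _ => f v).
Proof.
elim: n B c f => [|n IHn] B c f lec sumc /=.
  by rewrite (dropc0 B sumc) eqxx mulr1.
rewrite [LHS](bigID (fun i => 0 < c i)%N) /= [X in _ + X]big1 ?addr0; last first.
  (* Block [i] must keep its full length when [c i = 0], which is impossible once its head has been
     removed. *)
  move=> i /andP[Bi]; rewrite -leqNgt leqn0 => /eqP ci.
  rewrite -[RHS](shsum0 n (pop B i)); apply: eq_shsum => v c' _ _ _ _.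
  case: eqP => [|_]; last by rewrite mulr0.
  move/(congr1 (fun B : blocks => size (B i))); rewrite !ffunE ci drop0 eqxx.
  rewrite size_drop size_behead => eqs; case: (B i) Bi eqs => //= x b _ eqs.
  by have := leq_subr (c' i) (size b); rewrite eqs ltnn.
apply: eq_big => [i | i /andP[Bi ci]].
  have := lec i; rewrite ffunE; case: (B i) => [|x b] //=.
  by case: (c i).
pose c' : {ffun 'I_k -> nat} := [ffun j => (c j - (j == i))%N].
have sumc' : (\sum_j c' j = n)%N.
  have: (\sum_j c j = \sum_j c' j + \sum_j (j == i))%N.
    rewrite -big_split; apply: eq_bigr => j _; rewrite /= ffunE subnK //.
    by case: eqP => // ->.
  rewrite sumc [X in (_ + X)%N](bigD1 i) //= eqxx [X in (1 + X)%N]big1 => [|j /negPf->] //.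
  by rewrite addn1 => -[].
have lec' j : (c' j <= size (pop B i j))%N.
  rewrite !ffunE; case: eqP => [->|_]; last by rewrite subn0.
  by rewrite size_behead -subn1 leq_sub2r.
have -> : pop (takec c B) i = takec c' (pop B i).
  apply/ffunP=> j; rewrite !ffunE; case: eqP => [->|_]; last by rewrite subn0.
  case: (B i) => [|x b] //=.
  by case: (c i) ci => //= ci' _; rewrite subn1.
have -> : head 0%N (takec c B i) = head 0%N (B i).
  by rewrite ffunE; case: (B i) (c i) ci => [|x b] // [].
rewrite -IHn //; apply: eq_shsum => v c'' _ _ _ _.
congr (_ * (_ == _)%:R); apply/ffunP=> j; rewrite !ffunE.
case: eqP => [->|_]; last by rewrite subn0.
by rewrite -drop1 drop_drop subnK.
Qed.

Lemma shsum_single n B i f :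
    (forall j, j != i -> B j = [::]) -> size (B i) = n ->
  shsum n B (fun v _ => f v) = f (B i).
Proof.
elim: n B f => [|n IHn] B f Bj szB /=; first by rewrite (size0nil szB).
rewrite (big_pred1 i) => [|j].
  rewrite IHn.
  - by rewrite ffunE eqxx; case: (B i) szB.
  - by move=> j ji; rewrite ffunE (negPf ji) Bj.
  - by rewrite ffunE eqxx size_behead szB.
rewrite /=; case: (eqVneq j i) => [->|ji]; last by rewrite Bj.
by case: (B i) szB.
Qed.

(* The functionals annihilating proper shuffles are the Lie elements. *)
Definition lie_functional a f : Prop :=
  forall B i j, disjoint_blocks B -> (\sum_l size (B l) = a)%N ->
    i != j -> B i != [::] -> B j != [::] -> shsum a B (fun v _ => f v) = 0.

(** Group the terms by the numbers [c i] of letters taken from the blocks. By [shsum_take], each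
    group contains the sum of [f] over the shuffles of the prefixes, which is 0 when two prefixes
    are nonempty. Hence all [a] letters come from one block. *)
Lemma shsum_lie a B f (G : blocks -> R) :
    (0 < a)%N -> lie_functional a f -> disjoint_blocks B ->
  shsum a B (fun v B' => f v * G B') =
    \sum_(i | (a <= size (B i))%N) f (take a (B i)) * G (upd B i (drop a (B i))).
Proof.
move=> a0 fL dB.
pose nc (c : {ffun 'I_k -> 'I_a.+1}) : {ffun 'I_k -> nat} := [ffun i => nat_of_ord (c i)].
pose ok (c : {ffun 'I_k -> 'I_a.+1}) := (\sum_i nc c i == a)%N && [forall i, nc c i <= size (B i)]%N.
(* Each remainder [B'] equals [dropc (nc c) B] for exactly one admissible [c], so the inserted
   indicators add up to 1. The bound in ['I_a.+1] keeps the range of [c] finite. *)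
have -> : shsum a B (fun v B' => f v * G B') =
    shsum a B (fun v B' => \sum_(c | ok c)
      G (dropc (nc c) B) * (f v * (B' == dropc (nc c) B)%:R)).
  apply: eq_shsum => v c szv sumc lec _.
  have ca i : (c i < a.+1)%N by rewrite ltnS -sumc (bigD1 i) //= leq_addr.
  pose c' : {ffun 'I_k -> 'I_a.+1} := [ffun i => Ordinal (ca i)].
  have ncc' : nc c' = c by apply/ffunP=> i; rewrite !ffunE.
  rewrite (bigD1 c') /=; last by rewrite /ok ncc' sumc eqxx; apply/forallP.
  rewrite ncc' eqxx mulr1 mulrC big1 ?addr0 // => c'' /andP[/andP[_ /forallP lec''] c''c'].
  case: eqP => [eqd|_]; last by rewrite !mulr0.
  case/eqP: c''c'; apply/ffunP=> i; apply: val_inj; rewrite ffunE /=.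
  move/(congr1 (fun B : blocks => size (B i))): eqd; rewrite !ffunE !size_drop.
  move=> eqd; have := lec'' i; rewrite ffunE => le''.
  by rewrite -(subKn le'') -eqd subKn.
rewrite shsum_sum.
under eq_bigr => c /andP[/eqP sc /forallP lc] do rewrite shsumM shsum_take //.
pose X (c : {ffun 'I_k -> 'I_a.+1}) :=
  G (dropc (nc c) B) * shsum a (takec (nc c) B) (fun v _ => f v).
have XE (c : {ffun 'I_k -> 'I_a.+1}) : ok c -> X c = \sum_(i | nc c i == a) X c.
  case/andP=> /eqP sc /forallP lc.
  have [i nci | no] := pickP (fun i => nc c i == a).
    rewrite (big_pred1 i) // => j; apply/idP/eqP => [ncj|->//].
    apply/eqP/negPn/negP => ji; have := sc.
    rewrite (bigD1 i) //= (bigD1 j) //= (eqP ncj) (eqP nci) => /eqP.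
    by rewrite -[X in _ == X]addn0 eqn_add2l addn_eq0 (gtn_eqF a0).
  rewrite big_pred0 // /X.
  have [i ci] : exists i, (0 < nc c i)%N.
    apply/existsP; rewrite -[[exists _, _]]negbK negb_exists; apply/negP => /forallP c0.
    by move: a0; rewrite -sc big1 // => i _; apply/eqP; rewrite eqn0Ngt c0.
  have [j ji cj] : exists2 j, j != i & (0 < nc c j)%N.
    have [/existsP[j /andP[]]|] := boolP [exists j, (j != i) && (0 < nc c j)%N]; first by exists j.
    rewrite negb_exists => /forallP c0; have := no i.
    rewrite -sc (bigD1 i) //= big1 ?addn0 ?eqxx //.
    by move=> j ji; have := c0 j; rewrite ji /= => /negbTE; case: (nc c j).
  rewrite (fL _ i j) ?mulr0 //.
  - by apply: disjoint_sub dB => l; rewrite ffunE take_subseq.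
  - rewrite -sc; apply: eq_bigr => l _; rewrite ffunE size_take.
    by have := lc l; rewrite leq_eqVlt => /predU1P[->|->]; rewrite ?ltnn.
  - by rewrite eq_sym.
  - by rewrite ffunE -size_eq0 size_takel // -lt0n.
  - by rewrite ffunE -size_eq0 size_takel // -lt0n.
rewrite (eq_bigr _ XE) (exchange_big_dep predT) //= [RHS]big_mkcond; apply: eq_bigr => i _.
pose e : {ffun 'I_k -> 'I_a.+1} := [ffun j => if j == i then ord_max else ord0].
have nce j : nc e j = if j == i then a else 0%N by rewrite !ffunE; case: ifP.
have okP (c : {ffun 'I_k -> 'I_a.+1}) : ok c && (nc c i == a) = (c == e) && (a <= size (B i))%N.
  apply/idP/idP => [/andP[/andP[/eqP sc /forallP lc] /eqP ci] | /andP[/eqP-> leB]].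
    rewrite -{2}ci lc andbT; apply/eqP/ffunP=> j; apply: val_inj.
    rewrite ffunE; case: eqP => [->|/eqP ji] /=; first by rewrite -[RHS]ci ffunE.
    move/eqP: sc; rewrite (bigD1 i) //= ci -[X in _ == X]addn0 eqn_add2l.
    by rewrite sum_nat_eq0 => /forallP/(_ j); rewrite ji ffunE => /eqP.
  rewrite /ok nce eqxx eqxx andbT (bigD1 i) //= nce eqxx big1 ?addn0 ?eqxx => [|j /negPf ji].
    by apply/forallP=> j; rewrite nce; case: eqP => // ->.
  by rewrite nce ji.
rewrite (eq_bigl _ _ okP).
case: ifP => leB; last by rewrite big_pred0 // => c; rewrite andbF.
rewrite (big_pred1 e) => [|c]; last by rewrite andbT.
rewrite /X mulrC; congr (_ * G _); last first.
  by apply/ffunP=> j; rewrite [LHS]ffunE nce ffunE; case: eqP => [->|]; rewrite ?drop0.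
rewrite (@shsum_single _ _ i) ?ffunE ?nce ?eqxx ?size_takel // => j /negPf ji.
by rewrite ffunE nce ji take0.
Qed.

End Sums.
End Shuffles.

(** * Lists of shuffles, and the Dynkin element *)

Section ShuffleList.
Variable k : nat.
Local Notation blocks := {ffun 'I_k -> seq nat}.
Implicit Types (B : blocks) (v w : seq nat).

Fixpoint shuffles n B : seq (seq nat) :=
  if n is n'.+1 then
    [seq head 0%N (B i) :: v | i <- [seq i <- enum 'I_k | B i != [::]], v <- shuffles n' (pop B i)]
  else [:: [::]].

Lemma disjoint_pop B i : disjoint_blocks B -> disjoint_blocks (pop B i).
Proof. by apply: disjoint_sub => j; apply: subseq_pop. Qed.

Lemma head_notin_pop B i j : disjoint_blocks B -> B i != [::] ->
  head 0%N (B i) \notin pop B i j.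
Proof.
case=> uB dB Bi; rewrite ffunE; case: eqP => [_|/eqP ji].
  by have := uB i; case: (B i) Bi => //= x b _ /andP[].
apply/negP => Bj; case/eqP: ji; apply: dB Bj _.
by case: (B i) Bi => //= x b _; rewrite mem_head.
Qed.

(** In the direction from subsequences to shuffles, the first letter of [v] must head the block that
    contains it: an earlier letter of that block would have to precede it in [v]. *)
Lemma mem_shuffles n B v : disjoint_blocks B -> (\sum_i size (B i) = n)%N ->
  v \in shuffles n B <->
  [/\ uniq v, forall x, x \in v -> exists i, x \in B i & forall i, subseq (B i) v].
Proof.
elim: n B v => [|n IHn] B v dB szB /=.
  have B0 i : B i = [::].
    by apply/size0nil/eqP; move/eqP: szB; rewrite sum_nat_eq0 => /forallP/(_ i).
  rewrite inE; split=> [/eqP->|[_ + _]]; first by split=> // i; rewrite B0.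
  by case: v => // x v /(_ x (mem_head _ _))[i]; rewrite B0.
have szp i (Bi : B i != [::]) : (\sum_j size (pop B i j) = n)%N.
  by apply: succn_inj; rewrite sum_size_pop.
split.
  case/allpairsPdep=> i [v' [+ + ->]]; rewrite mem_filter mem_enum andbT => Bi.
  case/(IHn _ _ (disjoint_pop i dB) (szp i Bi)) => uv' memv' subv'; split.
  - rewrite /= uv' andbT; apply/negP => /memv'[j]; apply/negP.
    exact: head_notin_pop.
  - move=> x; rewrite inE => /predU1P[->|/memv'[j xj]].
      by exists i; case: (B i) Bi => //= y b _; rewrite mem_head.
    by exists j; apply: mem_subseq xj; apply: subseq_pop.
  move=> j; have := subv' j; rewrite ffunE; case: eqP => [->|_] sub.
    by case: (B i) Bi sub => //= y b _; rewrite eqxx.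
  by apply: subseq_trans sub _; apply: subseq_cons.
case: v => [|x v] [uv memv subv].
  have B0 i : B i = [::] by apply/eqP; rewrite -subseq0.
  by move: szB; rewrite big1 // => i _; rewrite B0.
have [i xi] := memv x (mem_head _ _).
move: uv => /= /andP[xv uv].
have defB : B i = x :: behead (B i) /\ subseq (behead (B i)) v.
  have := subv i; case: (B i) xi => //= z b; case: (eqVneq z x) => [->//|zx].
  rewrite inE eq_sym (negPf zx) /= => xb /mem_subseq/(_ x).
  by rewrite inE xb orbT => /(_ isT); rewrite (negPf xv).
have [defBi subBi] := defB.
apply/allpairsPdep; exists i, v; split.
- by rewrite mem_filter mem_enum defBi.
- apply/(IHn _ _ (disjoint_pop i dB) (szp i _)); first by rewrite defBi.
  split=> // [y yv | j].
    have [|j yj] := memv y; first by rewrite inE yv orbT.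
    exists j; rewrite ffunE; case: eqP yj => // ->; rewrite defBi inE /=.
    by case/predU1P=> // eyx; rewrite eyx (negPf xv) in yv.
  rewrite ffunE; case: eqP => [_|/eqP ji] //.
  have := subv j; case Bj: (B j) => [|z b]; rewrite ?sub0seq //=; case: (eqVneq z x) => // ezx.
  by case/eqP: ji; apply: (dB.2 j i x) => //; rewrite Bj ezx mem_head.
by rewrite defBi.
Qed.

Lemma shuffles_uniq n B : disjoint_blocks B -> uniq (shuffles n B).
Proof.
elim: n B => // n IHn B dB; apply: allpairs_uniq_dep.
- exact/filter_uniq/enum_uniq.
- by move=> i _; apply/IHn/disjoint_pop.
move=> [i v] [j v'] /allpairsPdep[i' [_ [Bi _ [-> _]]]] /allpairsPdep[j' [_ [Bj _ [-> _]]]] /=.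
move: Bi Bj; rewrite !mem_filter => /andP[Bi _] /andP[Bj _] [hij ->].
congr existT; apply: (dB.2 _ _ (head 0%N (B i'))).
  by case: (B i') Bi => //= y b _; rewrite mem_head.
by rewrite hij; case: (B j') Bj => //= y b _; rewrite mem_head.
Qed.

Lemma shsum_shuffles (R : comNzRingType) n B (f : seq nat -> R) :
  shsum n B (fun v _ => f v) = \sum_(v <- shuffles n B) f v.
Proof.
elim: n B f => [|n IHn] B f /=; first by rewrite big_seq1.
rewrite big_allpairs_dep big_filter big_enum_cond /=.
by apply: eq_bigr => i _; rewrite -IHn.
Qed.

Definition revb B : blocks := [ffun i => rev (B i)].

Lemma disjoint_revb B : disjoint_blocks B -> disjoint_blocks (revb B).
Proof.
case=> uB dB; split=> [i | i j x]; first by rewrite ffunE rev_uniq.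
by rewrite !ffunE !mem_rev; apply: dB.
Qed.

(** Reversal is a bijection onto the shuffles of the reversed blocks. It gives access to the last
    letter, while [shsum] peels off the first. *)
Lemma shsum_rev (R : comNzRingType) n B (f : seq nat -> R) :
    disjoint_blocks B -> (\sum_i size (B i) = n)%N ->
  shsum n B (fun v _ => f v) = shsum n (revb B) (fun v _ => f (rev v)).
Proof.
move=> dB szB; rewrite !shsum_shuffles -(big_map rev xpredT f).
apply: perm_big; apply: uniq_perm.
- exact: shuffles_uniq.
- by rewrite (map_inj_uniq (inv_inj (@revK _))); apply/shuffles_uniq/disjoint_revb.
have szr : (\sum_i size (revb B i) = n)%N.
  by rewrite -szB; apply: eq_bigr => i _; rewrite ffunE size_rev.
move=> v; rewrite -{2}[v]revK (mem_map (inv_inj (@revK _))).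
apply/idP/idP.
  case/(mem_shuffles _ dB szB) => uv memv subv; apply/(mem_shuffles _ (disjoint_revb dB) szr).
  split=> [|x|i]; first by rewrite rev_uniq.
    by rewrite mem_rev => /memv[i xi]; exists i; rewrite ffunE mem_rev.
  by rewrite ffunE subseq_rev.
case/(mem_shuffles _ (disjoint_revb dB) szr) => uv memv subv; apply/(mem_shuffles _ dB szB).
split=> [|x|i]; first by rewrite -rev_uniq.
  by rewrite -mem_rev => /memv[i]; rewrite ffunE mem_rev; exists i.
by have := subv i; rewrite ffunE subseq_rev.
Qed.

End ShuffleList.

(** * The Dynkin element on words and its vanishing on proper shuffles *)

Section Omega.
Variable R : comNzRingType.
Implicit Types (v w : seq nat).

(** On words of distinct letters: (-1)^k if the word falls for k steps and then rises to its end,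
    and 0 for words of any other shape. By [omegaE] these are the coefficients of [omega]. *)
Fixpoint omega_word v : R :=
  match v with
  | [::] => 0
  | x :: v' =>
      if v' is y :: _ then if (y < x)%N then - omega_word v' else (sorted ltn v')%:R else 1
  end.

Lemma omega_word_cons2 x y v :
  omega_word [:: x, y & v] = if (y < x)%N then - omega_word (y :: v) else (sorted ltn (y :: v))%:R.
Proof. by []. Qed.

Lemma omega_word_cons_max M v : v != [::] -> all (fun x => x < M)%N v -> omega_word (M :: v) = - omega_word v.
Proof. by case: v => //= y v _ /andP[-> _]. Qed.

Lemma omega_word_rcons_max M v : v != [::] -> all (fun x => x < M)%N v -> omega_word (rcons v M) = omega_word v.
Proof.
case: v => // x v _; elim: v x => [|y v IHv] x.
  by rewrite /= andbT => xM; rewrite ltnNge ltnW //= xM.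
move=> vM; have yvM : all (fun x => x < M)%N (y :: v) by case/andP: vM.
rewrite !rcons_cons !omega_word_cons2 -rcons_cons IHv //; case: ifP => // _; congr (nat_of_bool _)%:R.
rewrite /= rcons_path.
move/allP/(_ _ (mem_last y v)): yvM => /= ->.
by rewrite andbT.
Qed.

(** An interior maximum is a peak, and a word that first falls and then rises has none. *)
Lemma omega_word_mid_max M v w : v != [::] -> w != [::] -> all (fun x => x < M)%N w ->
  all (fun x => x < M)%N v -> omega_word (v ++ M :: w) = 0.
Proof.
case: v => // x v _; case: w => // z w _ zwM; elim: v x => [|y v IHv] x vM.
  rewrite /=; have [/andP[xM _] /andP[zM _]] := (vM, zwM).
  rewrite ltnNge ltnW //= [(M < z)%N]ltnNge ltnW //= andbF //.
have yvM : all (fun x => x < M)%N (y :: v) by case/andP: vM.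
rewrite !cat_cons omega_word_cons2 -cat_cons IHv // oppr0; case: ifP => // _.
case: (boolP (sorted _ _)) => // srt; have: sorted ltn [:: M; z].
  apply: subseq_sorted srt; first exact: ltn_trans.
  by apply: subseq_trans (suffix_subseq _ _); rewrite /= !eqxx sub0seq.
by rewrite /= andbT ltnNge ltnW //; case/andP: zwM.
Qed.

Lemma shsum_head k n (B : {ffun 'I_k -> seq nat}) (f : seq nat -> R) M l :
    disjoint_blocks B -> M \in B l ->
  shsum n.+1 B (fun v _ => f v *+ (head 0%N v == M)) =
    if head 0%N (B l) == M then shsum n (pop B l) (fun v _ => f (M :: v)) else 0.
Proof.
move=> dB Ml; have Bl : B l != [::] by case: (B l) Ml.
rewrite /= (bigD1 l) //= big1 ?addr0 => [|i /andP[Bi il]].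
  case: eqP => [->|_]; first by apply: eq_shsum.
  by rewrite -[RHS](shsum0 _ n (pop B l)); apply: eq_shsum => *; rewrite mulr0n.
rewrite -[RHS](shsum0 _ n (pop B i)); apply: eq_shsum => v c _ _ _ _.
case: eqP => [eqM|]; last by rewrite mulr0n.
case/eqP: il; apply: (dB.2 _ _ M) => //; rewrite -eqM.
by case: (B i) Bi => //= y b _; rewrite mem_head.
Qed.

Lemma max_block k (B : {ffun 'I_k -> seq nat}) i : B i != [::] ->
  exists2 M, (exists l, M \in B l) & forall j x, x \in B j -> (x <= M)%N.
Proof.
move=> Bi; pose w := flatten (codom B).
have memw x : x \in w -> exists j, x \in B j.
  by case/flattenP=> b /codomP[j ->] xb; exists j.
have wmem x j : x \in B j -> x \in w.
  by move=> xj; apply/flattenP; exists (B j); rewrite ?codom_f.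
have exw : exists x, x \in w.
  by case: (B i) Bi (@wmem^~ i) => // x b _ sub; exists x; apply: sub; rewrite mem_head.
have bound x : x \in w -> (x <= \max_(y <- w) y)%N.
  by move=> xw; apply: (@leq_bigmax_seq _ w xpredT id).
case: (ex_maxnP exw bound) => M Mw maxM; exists M; first exact: memw.
by move=> j x /wmem; apply: maxM.
Qed.

(* All terms vanish unless the largest letter M comes first or last.  If M is a  *)
(* block by itself, both cases cancel; otherwise removing M leaves the number of *)
(* nonempty blocks unchanged.                                                    *)
Lemma lie_omega_word k n : lie_functional k n omega_word.
Proof.
elim: n => [|n IHn] B i j dB szB ij Bi Bj.
  by move: szB Bi; rewrite (bigD1 i) //=; case: (B i).
have n0 : (0 < n)%N.
  move: szB; rewrite (bigD1 i) //= (bigD1 j) 1?eq_sym //=.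
  by case: (B i) (B j) Bi Bj => [|x b] // [|y b'] // _ _ /=; rewrite addSn addnS => -[<-].
have [M [l Ml] maxM] := max_block Bi.
have popM (B' : {ffun 'I_k -> seq nat}) (b : seq nat) :
    (forall x, x \in b -> exists j, x \in B' j) ->
    (forall j, B' j =i B j) -> M \notin b -> all (fun x => x < M)%N b.
  move=> memb eqB Mb; apply/allP => x xb /=; rewrite ltn_neqAle.
  have [j' xj] := memb x xb; rewrite (maxM j') -?eqB // andbT.
  by apply: contraNneq Mb => <-.
have split_om : shsum n.+1 B (fun v _ => omega_word v) =
    shsum n.+1 B (fun v _ => omega_word v *+ (head 0%N v == M)) +
    shsum n.+1 B (fun v _ => omega_word v *+ (last 0%N v == M)).
  rewrite !shsum_shuffles -big_split /= !big_seq; apply: eq_bigr => v.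
  rewrite -/(shuffles n.+1 B) => vB; have [uv memv subv] := (mem_shuffles v dB szB).1 vB.
  have Mv : M \in v by apply: (mem_subseq (subv l)).
  (* The nonempty blocks [i] and [j] are disjoint, so there are two letters and [M] cannot be first
     and last at once. *)
  have szv : (1 < size v)%N.
    have : (size (B i) + size (B j) <= size v)%N.
      rewrite -size_cat; apply: uniq_leq_size.
        rewrite cat_uniq !dB.1 andbT; apply/hasPn => x xj; apply/negP => xi.
        by case/eqP: ij; apply: (dB.2 _ _ x).
      by move=> x; rewrite mem_cat => /orP[]; apply: mem_subseq.
    by apply: leq_trans; case: (B i) (B j) Bi Bj => [|x b] // [|y b'] //= _ _; rewrite addnS.
  case/splitPr: Mv uv memv szv {subv vB} => v1 v2.
  rewrite -[M :: v2]cat1s uniq_catCA cat1s cons_uniq => /andP[Mv12 uv12] memv szv.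
  have [Mv1 Mv2] : M \notin v1 /\ M \notin v2 by apply/norP; rewrite -mem_cat.
  have lt1 : all (fun x => x < M)%N v1.
    by apply: (popM B) => // x xv; apply: memv; rewrite mem_cat xv.
  have lt2 : all (fun x => x < M)%N v2.
    by apply: (popM B) => // x xv; apply: memv; rewrite mem_cat inE xv !orbT.
  have om0 : v1 != [::] -> v2 != [::] -> omega_word (v1 ++ M :: v2) = 0.
    by move=> v10 v20; apply: omega_word_mid_max.
  have last1 : v1 != [::] -> head 0%N (v1 ++ M :: v2) != M.
    by case: (v1) lt1 => //= x v1' /andP[ltM _] _; rewrite neq_ltn ltM.
  have last2 : (last 0%N (v1 ++ M :: v2) == M) = (v2 == [::]).
    rewrite last_cat /=; case: (v2) Mv2 => [|y v2'] Mv2'; first by rewrite /= !eqxx.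
    by apply: contraNF Mv2' => /eqP <-; apply: mem_last.
  rewrite last2; case: (eqVneq v1 [::]) => [v10 | v10].
    rewrite v10 /= eqxx; case: eqP => [v20|]; last by rewrite addr0.
    by move: szv; rewrite v10 v20.
  by rewrite (negPf (last1 v10)) add0r; case: eqVneq => // v20; rewrite om0.
have dR := disjoint_revb dB.
have szR : (\sum_i size (revb B i) = n.+1)%N.
  by rewrite -szB; apply: eq_bigr => i' _; rewrite ffunE size_rev.
have MR : M \in revb B l by rewrite ffunE mem_rev.
have head_rev (v : seq nat) : last 0%N (rev v) = head 0%N v.
  by case: v => // x v; rewrite rev_cons last_rcons.
(* Reversing all words moves a final [M] to the front, where [shsum_head] applies to it as well. *)
rewrite split_om [X in _ + X](shsum_rev _ dB szB).
rewrite [X in _ + X](@eq_shsum _ _ _ _ _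
  (fun v _ => (omega_word \o rev) v *+ (head 0%N v == M))); last first.
  by move=> v c _ _ _ _; rewrite head_rev.
rewrite (shsum_head _ _ dB Ml) (shsum_head _ _ dR MR).
have Bl : B l != [::] by case: (B l) Ml.
have szp : (\sum_j size (pop B l j) = n)%N by apply: succn_inj; rewrite sum_size_pop.
have Rl : revb B l != [::] by case: (revb B l) MR.
have szpR : (\sum_j size (pop (revb B) l j) = n)%N by apply: succn_inj; rewrite sum_size_pop.
have ltM B' v (c : {ffun 'I_k -> nat}) : disjoint_blocks B' -> (forall j, B' j =i B j) ->
    head 0%N (B' l) = M -> size v = n ->
    (forall x, x \in v -> exists j, x \in pop B' l j) ->
    (v != [::]) && all (fun x => x < M)%N v.
  move=> dB' eqB hM szv memv; rewrite -size_eq0 szv -lt0n n0 /=.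
  apply/allP=> x /memv[j' xj] /=; rewrite ltn_neqAle (maxM j') ?andbT; last first.
    by rewrite -eqB; apply: mem_subseq xj; apply: subseq_pop.
  apply: contraTneq xj => ->; rewrite -hM head_notin_pop //.
  by have := Ml; rewrite -eqB; case: (B' l).
have -> : (if head 0%N (B l) == M then shsum n (pop B l) (fun v _ => omega_word (M :: v)) else 0) =
    - (if head 0%N (B l) == M then shsum n (pop B l) (fun v _ => omega_word v) else 0).
  case: eqP => [hM|_]; last by rewrite oppr0.
  rewrite -mulN1r -shsumM; apply: eq_shsum => v c szv _ _ memv.
  have /andP[v0 vM] := ltM B v c dB (fun _ _ => erefl) hM szv memv.
  by rewrite omega_word_cons_max // mulN1r.
have -> : (if head 0%N (revb B l) == M
           then shsum n (pop (revb B) l) (fun v _ => (omega_word \o rev) (M :: v)) else 0) =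
    if head 0%N (revb B l) == M then shsum n (revb (pop (revb B) l)) (fun v _ => omega_word v) else 0.
  case: eqP => [hM|_] //.
  have dP := disjoint_pop l dR.
  have szpR' : (\sum_j size (revb (pop (revb B) l) j) = n)%N.
    by rewrite -szpR; apply: eq_bigr => i' _; rewrite ffunE size_rev.
  rewrite [RHS](shsum_rev _ (disjoint_revb dP) szpR').
  have -> : revb (revb (pop (revb B) l)) = pop (revb B) l.
    by apply/ffunP=> i'; rewrite !ffunE; case: eqP => _; rewrite revK.
  apply: eq_shsum => v c szv _ _ memv /=.
  have eqB j' : revb B j' =i B j' by move=> x; rewrite ffunE mem_rev.
  have /andP[v0 vM] := ltM _ v c dR eqB hM szv memv.
  by rewrite rev_cons omega_word_rcons_max ?all_rev // -size_eq0 size_rev size_eq0.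
have [eqB | neqB] := eqVneq (B l) [:: M].
  rewrite !ffunE eqB /= eqxx (_ : revb _ = pop B l) ?addNr //.
  by apply/ffunP=> j'; rewrite !ffunE; case: eqP => _; rewrite ?revK ?eqB.
have pop0 : B l != [:: head 0%N (B l)] -> shsum n (pop B l) (fun v _ => omega_word v) = 0.
  move=> Bl1; apply: (IHn _ i j) => //; first exact: disjoint_pop.
    by rewrite ffunE; case: (_ =P l) => // _; case: (B l) Bl Bl1 => //= x [|y b] //; rewrite eqxx.
  by rewrite ffunE; case: (_ =P l) => // _; case: (B l) Bl Bl1 => //= x [|y b] //; rewrite eqxx.
rewrite [X in - X](_ : _ = 0) ?oppr0 ?add0r; last first.
  by case: eqP => // hM; apply: pop0; rewrite hM.
case: eqP => // hM; apply: (IHn _ i j) => //.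
- by apply/disjoint_revb/disjoint_pop.
- by rewrite -szpR; apply: eq_bigr => i' _; rewrite ffunE size_rev.
all: rewrite ffunE -size_eq0 size_rev ffunE; case: (_ =P l) => [_|].
all: try by rewrite ffunE size_rev size_eq0.
all: rewrite size_eq0; apply: contra neqB => /eqP revl; rewrite -[B l]revK; move: revl hM Rl.
all: by rewrite ffunE; case: (rev (B l)) => //= x b -> ->.
Qed.

End Omega.

(** * Left multiplication by Xi *)

Lemma sorted_blocksP (r w : seq nat) : size w = sumn r ->
  (forall i, i.+1 < size w -> nth 0 w i > nth 0 w i.+1 -> i.+1 \in scanl addn 0 r)%N <->
  all (sorted leq) (reshape r w).
Proof.
elim: r w => [|a r IHr] w /=; first by move=> /size0nil->.
move=> szw; have sz1 : size (take a w) = a by rewrite size_takel // szw leq_addr.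
have sz2 : size (drop a w) = sumn r by rewrite size_drop szw addKn.
have memS k : (0 < k)%N -> (k \in (0 + a)%N :: scanl addn (0 + a)%N r) =
    if (k <= a)%N then (k == a) else (k - a)%N \in scanl addn 0%N r.
  move=> k0; have := @mem_scanl_cat [:: a] r k k0; rewrite /= addn0 add0n => ->.
  by case: ifP => // _; rewrite inE orbb.
split=> [desw | /andP[/(sortedP 0%N) srt1 /(IHr _ sz2) srt2] i iw dw].
  apply/andP; split.
    apply/(sortedP 0%N) => i; rewrite sz1 => ia; rewrite leqNgt !nth_take //; last exact: ltnW.
    apply/negP => dw; have := desw i; rewrite szw dw memS // => /(_ _ isT).
    by rewrite (ltnW ia) (ltn_eqF ia) => /(_ (leq_trans ia (leq_addr _ _))).
  apply/(IHr _ sz2) => i; rewrite sz2 !nth_drop addnS => ir dw.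
  have ltw : ((a + i).+1 < size w)%N by lia.
  have := desw _ ltw dw; rewrite memS // leqNgt ltnS leq_addr /=.
  by rewrite -addnS addKn.
rewrite memS //; case: (ltngtP i.+1 a) => // ia.
  have := srt1 i; rewrite sz1 => /(_ ia).
  by rewrite !nth_take // ?(ltnW ia) // leqNgt dw.
rewrite subSn; last by [].
apply: srt2; first by rewrite sz2; lia.
by rewrite !nth_drop addnS subnKC // -ltnS.
Qed.

Section OneLine.
Variable n : nat.
Implicit Types (s t : 'S_n).

Lemma size_one_line s : size (one_line s) = n.
Proof. by rewrite /one_line size_map size_enum_ord. Qed.

Lemma nth_one_line s (i : 'I_n) : nth 0%N (one_line s) i = s i.
Proof. by rewrite (nth_map i) ?size_enum_ord // nth_ord_enum. Qed.

Lemma uniq_one_line s : uniq (one_line s).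
Proof.
rewrite map_inj_uniq ?enum_uniq // => i j /val_inj; exact: perm_inj.
Qed.

Lemma mem_one_line s x : (x \in one_line s) = (x < n)%N.
Proof.
apply/mapP/idP => [[i _ ->] | xn]; first exact: ltn_ord.
by exists (s^-1%g (Ordinal xn)); rewrite ?mem_enum // permKV.
Qed.

Lemma one_line_surj v : uniq v -> size v = n -> all (fun x => x < n)%N v ->
  exists s, one_line s = v.
Proof.
move=> uv szv vn.
have ltv (i : 'I_n) : (nth 0%N v i < n)%N by apply: (all_nthP 0%N vn); rewrite szv.
have inj : injective (fun i => Ordinal (ltv i)).
  move=> i j /(congr1 val) /= /eqP; rewrite nth_uniq ?szv // => /eqP.
  exact: val_inj.
exists (perm inj); apply: (@eq_from_nth _ 0%N); first by rewrite size_one_line.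
rewrite size_one_line => i i_n; rewrite -[i]/(val (Ordinal i_n)) nth_one_line.
by rewrite permE.
Qed.

Lemma one_line_inj : injective (@one_line n).
Proof.
move=> s t st; apply/permP=> i; apply: val_inj.
by rewrite /= -!nth_one_line st.
Qed.

(* In one-line notation t lists the positions of the letters of s in t^-1 * s. *)
Lemma one_line_index s t :
  one_line t = [seq index x (one_line (t^-1 * s)%g) | x <- one_line s].
Proof.
apply: (@eq_from_nth _ 0%N); first by rewrite size_map !size_one_line.
rewrite size_one_line => i i_n; rewrite (nth_map 0%N) ?size_one_line //.
rewrite -[i]/(val (Ordinal i_n)) !nth_one_line.
have -> : s (Ordinal i_n) = (t^-1 * s)%g (t (Ordinal i_n)) by rewrite permM permK.
by rewrite -[X in index X _]nth_one_line index_uniq ?uniq_one_line ?size_one_line.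
Qed.

End OneLine.

Definition wdes n (w : seq nat) : {set 'I_n.-1} :=
  [set i : 'I_n.-1 | nth 0%N w i > nth 0%N w i.+1]%N.

Lemma wdes_sub n r w : size w = n -> sumn r = n ->
  (wdes n w \subset wset n r) = all (sorted leq) (reshape r w).
Proof.
move=> szw sr; have szr : size w = sumn r by rewrite sr.
apply/subsetP/idP => [sub | /(sorted_blocksP szr) srt i].
  apply/(sorted_blocksP szr) => i iw dw.
  have i_n : (i < n.-1)%N by rewrite -szw; case: (size w) iw.
  by have := sub (Ordinal i_n); rewrite !inE => ->.
rewrite !inE => dw; apply: srt dw.
by rewrite szw; have := ltn_ord i; case: (n) i => [[]|].
Qed.

Lemma subseq_index_sorted (v b : seq nat) : uniq v -> {subset b <= v} ->
  subseq b v = sorted ltn [seq index x v | x <- b].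
Proof.
move=> uv bv.
have srtv : sorted (relpre (index^~ v) ltn) v.
  apply/(sortedP 0%N) => i iv /=; rewrite !index_uniq //; exact: ltnW.
have tr : transitive (relpre (index^~ v) ltn) by move=> x y z; apply: ltn_trans.
rewrite sorted_map; apply/idP/idP => [sub | srtb]; first exact: subseq_sorted sub srtv.
have <- : filter (mem b) v = b; last exact: filter_subseq.
apply: (irr_sorted_eq tr) => //.
- by move=> x /=; rewrite ltnn.
- exact: sorted_filter.
by move=> x; rewrite mem_filter /=; case xb: (x \in b) => //; rewrite bv.
Qed.

Lemma sorted_leq_uniq (b : seq nat) : uniq b -> sorted leq b = sorted ltn b.
Proof. by move=> ub; rewrite ltn_sorted_uniq_leq ub. Qed.

Definition blk k (r w : seq nat) : {ffun 'I_k -> seq nat} :=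
  [ffun i : 'I_k => nth [::] (reshape r w) (i : nat)].

Lemma reshape_map (T U : Type) (f : T -> U) r (w : seq T) :
  reshape r (map f w) = map (map f) (reshape r w).
Proof. by elim: r w => //= a r IHr w; rewrite -IHr map_take map_drop. Qed.

Lemma uniq_flatten_nth (ss : seq (seq nat)) : uniq (flatten ss) ->
  (forall i, uniq (nth [::] ss i)) /\
  (forall i j x, x \in nth [::] ss i -> x \in nth [::] ss j -> i = j).
Proof.
elim: ss => [_|b ss IHss] /=; first by split=> [i|i j x]; rewrite nth_nil.
rewrite cat_uniq => /and3P[ub /hasPn dbs /IHss[uss dss]].
have notin j x : x \in nth [::] ss j -> x \notin b.
  move=> xj; apply: dbs; apply/flattenP; exists (nth [::] ss j) => //.
  by apply: mem_nth; rewrite ltnNge; apply: contraTN xj => szj; rewrite nth_default.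
split=> [[|i] // | [|i] [|j] x //=]; first exact: uss.
- by move=> xb /notin; rewrite xb.
- by move=> /notin/negPf->.
by move=> xi /(dss _ _ _ xi)->.
Qed.

Section Blocks.
Variables (k : nat) (r w : seq nat).
Hypotheses (szr : size r = k) (szw : size w = sumn r).

Lemma disjoint_blk : uniq w -> disjoint_blocks (blk k r w).
Proof.
move=> uw; have := @uniq_flatten_nth (reshape r w); rewrite reshapeKr ?szw // => /(_ uw)[ub db].
split=> [i | i j x]; rewrite !ffunE //.
by move=> xi /(db _ _ _ xi) ij; apply: val_inj.
Qed.

Lemma size_blk (i : 'I_k) : size (blk k r w i) = nth 0%N r i.
Proof.
rewrite ffunE -[in RHS](@reshapeKl _ r w) ?szw // /shape (nth_map [::]) //.
by rewrite size_reshape szr.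
Qed.

Lemma sum_size_blk : (\sum_i size (blk k r w i) = sumn r)%N.
Proof.
under eq_bigr do rewrite size_blk.
by rewrite sumnE (big_nth 0%N) szr big_mkord.
Qed.

Lemma mem_blk x : x \in w <-> exists i, x \in blk k r w i.
Proof.
rewrite -[w in x \in w](@reshapeKr _ r) ?szw //; split=> [/flattenP[b bw xb] | [i]].
  move: xb; rewrite -(nth_index [::] bw) => xb.
  have ik : (index b (reshape r w) < k)%N by rewrite -szr -(size_reshape r w) index_mem.
  by exists (Ordinal ik); rewrite ffunE.
rewrite ffunE => xi; apply/flattenP; exists (nth [::] (reshape r w) i) => //.
by rewrite mem_nth // size_reshape szr.
Qed.

Lemma all_blk (P : pred (seq nat)) :
  all P (reshape r w) <-> forall i, P (blk k r w i).
Proof.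
split=> [/all_nthP allP i | allP].
  by rewrite ffunE; apply: allP; rewrite size_reshape szr.
apply/(all_nthP [::]) => i; rewrite size_reshape szr => ik.
by have := allP (Ordinal ik); rewrite ffunE.
Qed.

End Blocks.

(** The product at [s] sums the values of [f] at [t^-1 * s] over all [t] with descents in
    [wset n r], that is, increasing on the blocks of [r]. As [t] lists the positions of the letters
    of [s] in [t^-1 * s], this says that the blocks of [s] are subwords of [t^-1 * s]: these words
    are exactly the shuffles of the blocks. *)
Lemma mulXi (K : fieldType) n k r (H : seq nat -> K) (f : 'KS[K]_n) (s : 'S_n) :
    size r = k -> sumn r = n -> (forall t, (f : {ffun _ -> _}) t = H (one_line t)) ->
  (Xi K (wset n r) * f : {ffun _ -> _}) s =
    shsum n (blk k r (one_line s)) (fun v _ => H v).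
Proof.
move=> szr sr fH; rewrite ffunE shsum_shuffles.
pose inD t := Des t \subset wset n r.
under eq_bigr => t _ do rewrite Xi_ffunE -/(inD t) fH mulrC mulr_natr mulrb.
rewrite -big_mkcond -big_filter /=.
rewrite -(big_map (fun t => one_line (t^-1 * s)%g) xpredT H).
have szw : size (one_line s) = sumn r by rewrite size_one_line sr.
have dB := @disjoint_blk k _ _ szw (uniq_one_line s).
have szB : (\sum_i size (blk k r (one_line s) i) = n)%N by rewrite (sum_size_blk szr szw).
have inDE t : inD t <->
    forall i, subseq (blk k r (one_line s) i) (one_line (t^-1 * s)%g).
  rewrite /inD -[Des t]/(wdes n (one_line t)) wdes_sub ?size_one_line //.
  have szt : size (one_line t) = sumn r by rewrite size_one_line sr.
  have ext i : sorted leq (blk k r (one_line t) i) =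
      subseq (blk k r (one_line s) i) (one_line (t^-1 * s)%g).
    rewrite subseq_index_sorted ?uniq_one_line //; last first.
      move=> x xi; rewrite mem_one_line -(mem_one_line s).
      by apply/(mem_blk szr szw); exists i.
    rewrite sorted_leq_uniq; last by have [] := @disjoint_blk k _ _ szt (uniq_one_line t).
    congr sorted; rewrite !ffunE (one_line_index s t) reshape_map.
    by rewrite (nth_map [::]) // size_reshape szr.
  split=> [/(all_blk _ szr) all_i i|all_i]; first by rewrite -ext.
  by apply/(all_blk _ szr) => i; rewrite ext.
apply/perm_big/uniq_perm.
- rewrite map_inj_in_uniq ?filter_uniq ?index_enum_uniq // => t u _ _.
  by move/one_line_inj/mulIg/invg_inj.
- exact: shuffles_uniq.
move=> v; apply/mapP/idP => [[t + ->] | ].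
  rewrite mem_filter => /andP[/inDE sub _]; apply/(mem_shuffles _ dB szB).
  split=> // [|x]; first exact: uniq_one_line.
  by rewrite mem_one_line -(mem_one_line s) => /(mem_blk szr szw).
case/(mem_shuffles _ dB szB) => uv memv subv.
have eqv : v =i one_line s.
  move=> x; apply/idP/idP => [/memv/(mem_blk szr szw) // | /(mem_blk szr szw)[i]].
  exact: mem_subseq.
have szv : size v = n.
  rewrite -(size_one_line s); apply/eqP.
  by rewrite -uniq_size_uniq ?uniq_one_line // => x; rewrite eqv.
have [|u uE] := one_line_surj uv szv; first by apply/allP=> x; rewrite eqv mem_one_line.
exists (s * u^-1)%g; last by rewrite invMg invgK mulgKV uE.
rewrite mem_filter mem_index_enum andbT; apply/inDE => i.
by rewrite invMg invgK mulgKV uE.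
Qed.

(** * Functions of descents and peaks, and their outer products *)

Lemma galg_sumE (K : fieldType) (gT : finGroupType) (I : Type) (r : seq I) (P : pred I)
    (F : I -> galg K gT) x :
  (\sum_(i <- r | P i) F i : {ffun _ -> _}) x = \sum_(i <- r | P i) (F i : {ffun _ -> _}) x :> K.
Proof. by rewrite sum_ffunE. Qed.

Lemma galg_scaleE (K : fieldType) (gT : finGroupType) a (f : galg K gT) x :
  (a *: f : {ffun _ -> _}) x = a * (f : {ffun _ -> _}) x :> K.
Proof. by rewrite ffunE. Qed.

Lemma class_sumE (K : fieldType) (gT : finGroupType) (P : pred gT) x :
  (\sum_(y | P y) gelt K y : {ffun _ -> _}) x = (P x)%:R :> K.
Proof.
rewrite galg_sumE; case: (boolP (P x)) => Px.
  rewrite (bigD1 x) //= ffunE eqxx big1 ?addr0 // => y /andP[_ yx].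
  by rewrite ffunE eq_sym (negPf yx).
by rewrite big1 // => y Py; rewrite ffunE; case: eqP => // xy; rewrite xy Py in Px.
Qed.

Lemma span_class_sumsP (K : fieldType) (gT : finGroupType) (T : finType) (c : gT -> T)
    (f : galg K gT) :
  f \in <<[seq (\sum_(y | c y == x) gelt K y)%R | x : T]>>%VS <->
  (forall y z, c y = c z -> (f : {ffun _ -> _}) y = (f : {ffun _ -> _}) z).
Proof.
split=> [fX y z cyz | fc].
  rewrite (coord_span fX) !galg_sumE; apply: eq_bigr => i _.
  rewrite !galg_scaleE; congr (_ * _).
  rewrite -tnth_nth.
  have /mapP[x _ ->] := mem_tnth i (image_tuple (fun x => \sum_(y | c y == x) gelt K y) T).
  by rewrite !class_sumE cyz.
(* The default value is harmless: the class sum of an empty fibre is 0. *)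
pose val x : K := if [pick y | c y == x] is Some y then (f : {ffun _ -> _}) y else 0.
have -> : f = \sum_x val x *: \sum_(y | c y == x) gelt K y.
  apply/ffunP=> z; rewrite galg_sumE (bigD1 (c z)) //= [X in _ + X]big1 ?addr0 => [|x xz].
    rewrite galg_scaleE class_sumE eqxx mulr1 /val; case: pickP => [y /eqP /fc //|/(_ z)].
    by rewrite eqxx.
  by rewrite galg_scaleE class_sumE eq_sym (negPf xz) mulr0.
by apply: memv_suml => x _; apply/memvZ/memv_span/imageP; exists x.
Qed.

Lemma descent_algP (K : fieldType) n (f : 'KS[K]_n) :
  f \in descent_alg K n <->
  (forall s t, Des s = Des t -> (f : {ffun _ -> _}) s = (f : {ffun _ -> _}) t).
Proof. exact: span_class_sumsP. Qed.

Lemma peak_algP (K : fieldType) n (f : 'KS[K]_n) :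
  f \in peak_alg K n <->
  (forall s t, Peak s = Peak t -> (f : {ffun _ -> _}) s = (f : {ffun _ -> _}) t).
Proof. exact: span_class_sumsP. Qed.

(** The [pick] always succeeds, by [Des_surj]. *)
Definition des_rep n (D : {set 'I_n.-1}) : 'S_n := odflt 1%g [pick s | Des s == D].

Lemma Des_rep n (D : {set 'I_n.-1}) : Des (des_rep D) = D.
Proof.
rewrite /des_rep; case: pickP => [s /eqP //|]; have [s <-] := Des_surj D.
by move/(_ s); rewrite eqxx.
Qed.

(* The value at the word w of the function of descent sets f. *)
Definition lv (K : fieldType) n (f : 'KS[K]_n) (w : seq nat) : K :=
  (f : {ffun _ -> _}) (des_rep (wdes n w)).

Section Descents.
Variable K : fieldType.

Lemma lv_one_line n (f : 'KS[K]_n) s : f \in descent_alg K n ->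
  lv f (one_line s) = (f : {ffun _ -> _}) s.
Proof. by move/descent_algP; apply; rewrite Des_rep. Qed.

Lemma lv_sum n (I : finType) (F : I -> 'KS[K]_n) w : lv (\sum_i F i) w = \sum_i lv (F i) w.
Proof. exact: galg_sumE. Qed.

Lemma lvZ n a (f : 'KS[K]_n) w : lv (a *: f) w = a * lv f w.
Proof. exact: galg_scaleE. Qed.

Lemma lv_Xi n (D : {set 'I_n.-1}) w : lv (Xi K D) w = (wdes n w \subset D)%:R.
Proof. by rewrite /lv Xi_ffunE Des_rep. Qed.

Lemma Xi_descent n (D : {set 'I_n.-1}) : Xi K D \in descent_alg K n.
Proof. by apply/descent_algP => s t st; rewrite !Xi_ffunE st. Qed.

Lemma descent_alg_Xi n : descent_alg K n = <<Xi_basis K n>>%VS.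
Proof.
apply/esym/eqP; rewrite eqEdim; apply/andP; split.
  by apply/span_subvP => _ /mapP[i _ ->]; apply: Xi_descent.
have /eqP-> := Xi_free K n; rewrite size_tuple; apply: leq_trans (dim_span _) _.
by rewrite size_map -cardE.
Qed.

Lemma dim_descent_alg n : \dim (descent_alg K n) = #|{set 'I_n.-1}|.
Proof. by rewrite descent_alg_Xi; have /eqP-> := Xi_free K n; rewrite size_tuple. Qed.

Lemma Xi_expand n (f : 'KS[K]_n) : f \in descent_alg K n ->
  f = \sum_D Xi_coord D f *: Xi K D.
Proof.
rewrite descent_alg_Xi => /coord_span {1}->.
rewrite (reindex (@enum_rank _)); last by apply: onW_bij; apply: enum_rank_bij.
by apply: eq_bigr => D _; rewrite nth_Xi_basis.
Qed.

Lemma Xi_coordZ n (D : {set 'I_n.-1}) a (f : 'KS[K]_n) :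
  Xi_coord D (a *: f) = a * Xi_coord D f.
Proof. exact: linearZ. Qed.

Lemma Xi_coord_sum n (D : {set 'I_n.-1}) (I : finType) (F : I -> 'KS[K]_n) :
  Xi_coord D (\sum_i F i) = \sum_i Xi_coord D (F i).
Proof. exact: linear_sum. Qed.

Lemma outer_descent m n (x : 'KS[K]_m) (y : 'KS[K]_n) : outer x y \in descent_alg K (m + n).
Proof.
by apply: memv_suml => D _; apply: memv_suml => E _; apply/memvZ/Xi_descent.
Qed.

Lemma reshape_cat (r q w : seq nat) :
  reshape (r ++ q) w = reshape r (take (sumn r) w) ++ reshape q (drop (sumn r) w).
Proof.
elim: r w => [|a r IHr] w /=; first by rewrite drop0.
by rewrite IHr take_takel ?leq_addr // drop_drop take_drop addnC.
Qed.

(** By bilinearity it is enough to treat basis elements. [Xi] tests whether the blocks of [w] are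
    increasing, and the blocks for a concatenation are those of the first [m] letters followed by
    those of the rest. *)
Lemma lv_outer m n (x : 'KS[K]_m) (y : 'KS[K]_n) w :
    x \in descent_alg K m -> y \in descent_alg K n -> size w = (m + n)%N ->
  lv (outer x y) w = lv x (take m w) * lv y (drop m w).
Proof.
move=> xD yD szw; rewrite [in RHS](Xi_expand xD) [in RHS](Xi_expand yD).
rewrite !lv_sum mulr_suml; apply: eq_bigr => D _.
rewrite lv_sum mulr_sumr; apply: eq_bigr => E _.
rewrite !lvZ !lv_Xi mulrACA; congr (_ * _).
have szt : size (take m w) = m by rewrite size_takel // szw leq_addr.
have szd : size (drop m w) = n by rewrite size_drop szw addKn.
rewrite wdes_sub // ?sumn_cat ?sumn_setw // reshape_cat all_cat sumn_setw.
rewrite -{2}(setwK D) -{2}(setwK E) !wdes_sub ?sumn_setw //.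
by case: (all _ _); rewrite ?mul1r ?mul0r.
Qed.

(** The ascent is written as the absence of a descent, so that the set depends on [wdes] alone even
    when letters repeat. *)
Definition wpeak n (w : seq nat) : {set 'I_n.-2} :=
  [set i : 'I_n.-2 | ~~ (nth 0 w i > nth 0 w i.+1)%N && (nth 0 w i.+1 > nth 0 w i.+2)%N].

Lemma Peak_wpeak n (s : 'S_n) : Peak s = wpeak n (one_line s).
Proof.
apply/setP=> i; rewrite !inE; congr (_ && _).
have i_n : (i.+2 < n)%N by have := ltn_ord i; lia.
rewrite -leqNgt ltn_neqAle nth_uniq ?uniq_one_line ?size_one_line //; [|lia..].
by rewrite (ltn_eqF (ltnSn i)).
Qed.

Lemma wpeak_wdes n v w : wdes n v = wdes n w -> wpeak n v = wpeak n w.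
Proof.
move/setP=> vw; apply/setP=> i.
have i1 : (i < n.-1)%N by have := ltn_ord i; lia.
have i2 : (i.+1 < n.-1)%N by have := ltn_ord i; lia.
by have := (vw (Ordinal i1), vw (Ordinal i2)); rewrite !inE /= => -[-> ->].
Qed.

Lemma lv_peak n (f : 'KS[K]_n) v w : f \in peak_alg K n ->
  wpeak n v = wpeak n w -> lv f v = lv f w.
Proof.
move/peak_algP=> fP vw; apply: fP; rewrite !Peak_wpeak.
have rep u : wpeak n (one_line (des_rep (wdes n u))) = wpeak n u.
  by apply: wpeak_wdes; apply: Des_rep.
by rewrite !rep.
Qed.

Lemma wpeak_cat m n v w : size v = (m + n)%N -> size w = (m + n)%N ->
    wpeak (m + n) v = wpeak (m + n) w ->
  wpeak m (take m v) = wpeak m (take m w) /\ wpeak n (drop m v) = wpeak n (drop m w).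
Proof.
move=> szv szw /setP vw; split; apply/setP=> i.
  have i_m : (i.+2 < m)%N by have := ltn_ord i; lia.
  have i_mn : (i < (m + n).-2)%N by lia.
  have := vw (Ordinal i_mn); rewrite !inE /= !nth_take //; lia.
have i_n : (i.+2 < n)%N by have := ltn_ord i; lia.
have i_mn : (m + i < (m + n).-2)%N by lia.
by have := vw (Ordinal i_mn); rewrite !inE /= !nth_drop !addnS.
Qed.

Lemma peak_sub_descent n : (peak_alg K n <= descent_alg K n)%VS.
Proof.
apply/subvP=> f /peak_algP fP; apply/descent_algP => s t st; apply: fP.
by rewrite !Peak_wpeak; apply: wpeak_wdes.
Qed.

(** By [lv_outer] the value at a word depends only on the peaks of its two factors. A peak of a
    factor involves three consecutive letters of it, so it is already a peak of the whole word. *)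
Lemma outer_peak m n (x : 'KS[K]_m) (y : 'KS[K]_n) :
  x \in peak_alg K m -> y \in peak_alg K n -> outer x y \in peak_alg K (m + n).
Proof.
move=> xP yP; have xD := subvP (peak_sub_descent m) x xP.
have yD := subvP (peak_sub_descent n) y yP.
apply/peak_algP => s t; rewrite !Peak_wpeak => st.
rewrite -!(lv_one_line _ (outer_descent x y)) !lv_outer ?size_one_line //.
have [st1 st2] := wpeak_cat (size_one_line s) (size_one_line t) st.
by rewrite (lv_peak xP st1) (lv_peak yP st2).
Qed.

End Descents.

(** * Outer products of the series as functions on words *)

Section OuterWords.
Variables (K : fieldType) (g : forall m, 'KS[K]_m).
Hypothesis g_desc : forall m, (0 < m)%N -> g m \in descent_alg K m.

Fixpoint gw (q w : seq nat) : K :=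
  if q is a :: q' then lv (g a) (take a w) * gw q' (drop a w) else 1.

(** This gives g_q by its values in a freely chosen degree [n], which avoids casts along
    [sumn q = n]; see [gam_outer_word]. *)
Definition gam n (q : seq nat) : 'KS[K]_n := [ffun s => gw q (one_line s)].

Lemma gamE n q (s : 'S_n) : (gam n q : {ffun _ -> _}) s = gw q (one_line s).
Proof. by rewrite ffunE. Qed.

Lemma S0_eq (s t : 'S_0) : s = t.
Proof. by apply/permP=> -[]. Qed.

Lemma outer_word_descent q : outer_word g q \in descent_alg K (sumn q).
Proof.
case: q => [|a q] /=; last exact: outer_descent.
by apply/descent_algP => s t _; rewrite (S0_eq s t).
Qed.

Lemma lv_outer_word q w : 0%N \notin q -> size w = sumn q ->
  lv (outer_word g q) w = gw q w.
Proof.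
elim: q w => [|a q IHq] w /=.
  by rewrite /lv => _ _; rewrite ffunE (S0_eq (des_rep _) 1%g) eqxx.
rewrite inE negb_or eq_sym -lt0n => /andP[a0 q0] szw.
rewrite lv_outer ?g_desc ?outer_word_descent // IHq //.
by rewrite size_drop szw addKn.
Qed.

Lemma gam_outer_word n q (e : sumn q = n) : 0%N \notin q ->
  ecast m 'KS[K]_m e (outer_word g q) = gam n q.
Proof.
case: n / e => q0 /=; apply/ffunP=> s; rewrite gamE -lv_outer_word ?size_one_line //.
by rewrite lv_one_line ?outer_word_descent.
Qed.

Lemma outer_partition_gam n (p : partition_of n) : outer_partition g p = gam n (parts p).
Proof. by apply: gam_outer_word; have /and3P[] := valP p. Qed.

Lemma gam_descent n q : 0%N \notin q -> sumn q = n -> gam n q \in descent_alg K n.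
Proof.
move=> q0 e; rewrite -(gam_outer_word e q0); case: n / e => /=.
exact: outer_word_descent.
Qed.

Lemma gam_peak n q : (forall m, odd m -> g m \in peak_alg K m) ->
  all odd q -> sumn q = n -> gam n q \in peak_alg K n.
Proof.
move=> gP qo e; have q0 : 0%N \notin q by apply/negP => /(allP qo).
rewrite -(gam_outer_word e q0); case: n / e => /=.
elim: q qo {q0} => [_|a q IHq] /=; first by apply/peak_algP => s t _; rewrite (S0_eq s t).
by case/andP=> /gP aP /IHq qP; apply: outer_peak.
Qed.

End OuterWords.

(** * Products of Lie functionals *)

Section Distributions.
Variable k : nat.
Implicit Types (U B : {ffun 'I_k -> seq nat}) (q : seq nat).

(** A list and not a set: if [q] has repeated letters, the same family of words arises several times
    and is counted with multiplicity. *)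
Fixpoint distributions q : seq {ffun 'I_k -> seq nat} :=
  if q is a :: q' then [seq upd U i (a :: U i) | U <- distributions q', i <- enum 'I_k]
  else [:: [ffun=> [::]]].

Definition concat B := flatten [seq B i | i <- enum 'I_k].

Lemma count_concat (p : pred nat) B : count p (concat B) = (\sum_i count p (B i))%N.
Proof. by rewrite count_flatten sumnE -map_comp big_map big_enum. Qed.

Lemma count_upd (p : pred nat) B i b :
  (\sum_j count p (upd B i b j) + count p (B i) = \sum_j count p (B j) + count p b)%N.
Proof.
rewrite (bigD1 i) //= [X in _ = (X + _)%N](bigD1 i) //= ffunE eqxx.
under eq_bigr => j /negPf ji do rewrite ffunE ji.
by rewrite addnAC [in RHS]addnAC (addnC (count p b)).
Qed.

Lemma perm_distributions q U : U \in distributions q -> perm_eq (concat U) q.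
Proof.
move=> Uq; apply/seq.permP=> p; rewrite count_concat.
elim: q U Uq => [|a q IHq] U /=.
  by rewrite inE => /eqP->; rewrite big1 // => i _; rewrite ffunE.
case/allpairsP=> -[U' i] [/= /IHq IH _ ->]; have := count_upd p U' i (a :: U' i).
by rewrite IH /= => eqc; lia.
Qed.

Lemma mem_distributions_single q U :
  (forall i, size (U i) <= 1)%N -> perm_eq (concat U) q -> U \in distributions q.
Proof.
elim: q U => [|a q IHq] U szU pU /=.
  have U0 : concat U = [::] by apply/perm_small_eq.
  rewrite inE; apply/eqP/ffunP=> i; rewrite ffunE; apply/eqP.
  rewrite -size_eq0 -leqn0 -[X in (_ <= X)%N](congr1 size U0) -!(count_predT (U i)).
  by rewrite -count_predT count_concat (bigD1 i) //= leq_addr.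
have /flattenP[b /mapP[i _ ->] aU] : a \in concat U by rewrite (perm_mem pU) mem_head.
have Ui : U i = [:: a].
  by case: (U i) (szU i) aU => [|x [|y b']] // _; rewrite inE => /eqP->.
apply/allpairsP; exists (upd U i [::], i); rewrite mem_enum; split=> //=.
  apply: IHq => [j|]; first by rewrite ffunE; case: eqP.
  rewrite -(perm_cons a); apply: perm_trans pU; apply/seq.permP=> p.
  rewrite /= !count_concat; have := count_upd p U i [::].
  by rewrite Ui /= addn0 => eqc; lia.
by apply/ffunP=> j; rewrite !ffunE eqxx; case: eqP => // ->.
Qed.

End Distributions.

Section Lie.
Variables (K : fieldType) (g : forall m, 'KS[K]_m).
Hypothesis g_lie_functional :
  forall k m, (0 < m)%N -> lie_functional k m (lv (g m)).

(** Induction on [q]. By [shsum_lie] the factor for the first letter [a] of [q] consumes a prefix of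
    length [a] of a single block [i]; accordingly [a] becomes the first letter of [U i]. *)
Lemma shsum_gw k (q : seq nat) (B : {ffun 'I_k -> seq nat}) : 0%N \notin q ->
    disjoint_blocks B -> (\sum_i size (B i) = sumn q)%N ->
  shsum (sumn q) B (fun v _ => gw g q v) =
    \sum_(U <- distributions k q | [forall i, sumn (U i) == size (B i)]) \prod_i gw g (U i) (B i).
Proof.
elim: q B => [|a q IHq] B /=.
  move=> _ _ /eqP; rewrite sum_nat_eq0 => /forallP szB.
  rewrite big_cons big_nil ifT ?addr0.
    by rewrite big1 // => i _; rewrite ffunE.
  by apply/forallP=> i; rewrite ffunE eq_sym; apply: szB.
rewrite inE negb_or eq_sym -lt0n => /andP[a0 q0] dB szB.
rewrite shsum_cat.
rewrite (@eq_shsum _ _ _ _ _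
    (fun v B' => lv (g a) v * shsum (sumn q) B' (fun v' _ => gw g q v'))); last first.
  move=> v c szv _ _ _; rewrite -shsumM; apply: eq_shsum => v' _ _ _ _ _.
  by rewrite take_size_cat // drop_size_cat.
rewrite (shsum_lie _ a0 (g_lie_functional (m := a) a0) dB).
rewrite [LHS]big_mkcond [RHS]big_mkcond big_allpairs_dep exchange_big /= big_enum /=.
apply: eq_bigr => i _; pose B' := upd B i (drop a (B i)).
have okU (U : {ffun 'I_k -> seq nat}) :
    [forall j, sumn (upd U i (a :: U i) j) == size (B j)] =
    (a <= size (B i))%N && [forall j, sumn (U j) == size (B' j)].
  apply/forallP/andP => [sU | [leB /forallP sU] j].
    have := sU i; rewrite ffunE eqxx /= => /eqP sUi; split; first by rewrite -sUi leq_addr.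
    apply/forallP=> j; have := sU j; rewrite !ffunE; case: (j =P i) => // -> _.
    by rewrite size_drop -sUi addKn.
  have := sU j; rewrite !ffunE; case: (_ =P i) => [->|] //=; rewrite size_drop => /eqP->.
  by rewrite subnKC.
case: ifP => leB; last by rewrite big1 // => U _; rewrite okU leB.
have dB' : disjoint_blocks B'.
  apply: disjoint_sub dB => j; rewrite ffunE; case: (_ =P i) => // ->; exact: drop_subseq.
have szB' : (\sum_j size (B' j) = sumn q)%N.
  by have := sum_size_upd B i (drop a (B i)); rewrite -/B' szB size_drop; lia.
rewrite IHq // mulr_sumr big_mkcond; apply: eq_bigr => U _; rewrite okU leB /=.
case: ifP => // _; rewrite (bigD1 i) //= [in RHS](bigD1 i) //= !ffunE eqxx mulrA.
congr (_ * _); apply: eq_bigr => j /negPf ji; by rewrite !ffunE ji.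
Qed.

Lemma gw_cat u u' v v' : sumn u = size v -> gw g (u ++ u') (v ++ v') = gw g u v * gw g u' v'.
Proof.
elim: u v => [|a u IHu] v /=; first by move/esym/size0nil->; rewrite mul1r.
move=> szv; have av : (a <= size v)%N by rewrite -szv leq_addr.
rewrite takel_cat // drop_cat; case: ltnP => [av'|va].
  by rewrite IHu ?mulrA // size_drop -szv addKn.
have eqa : a = size v by apply/eqP; rewrite eqn_leq av va.
have u0 : sumn u = 0%N by lia.
have -> : (a - size v = 0)%N by rewrite eqa subnn.
rewrite drop0 -[v']/([::] ++ v') IHu // mulrA.
by rewrite (@drop_oversize _ a v) // eqa.
Qed.

Lemma gw_concat k (U B : {ffun 'I_k -> seq nat}) : (forall i, sumn (U i) = size (B i)) ->
  \prod_i gw g (U i) (B i) = gw g (concat U) (concat B).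
Proof.
move=> UB; rewrite /concat -big_enum /=; elim: (enum 'I_k) => [|i s IHs] /=.
  by rewrite big_nil.
by rewrite big_cons IHs -gw_cat.
Qed.

Lemma concat_blk k r w : size r = k -> size w = sumn r -> concat (blk k r w) = w.
Proof.
move=> szr szw; rewrite -[RHS](@reshapeKr _ r) ?szw //; congr flatten.
apply: (@eq_from_nth _ [::]); first by rewrite size_map size_enum_ord size_reshape.
rewrite size_map size_enum_ord => i ik.
by rewrite (nth_map (Ordinal ik)) ?size_enum_ord // ffunE (nth_ord_enum _ (Ordinal ik)).
Qed.

(** Cut the word of a permutation into blocks of lengths [r], expand the shuffle sum by [shsum_gw],
    and glue the values on the blocks together again by [gw_concat]. *)
Lemma mulXi_gam n (r q : seq nat) : 0%N \notin q -> sumn q = n -> sumn r = n ->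
  Xi K (wset n r) * gam g n q =
    \sum_(U <- distributions (size r) q | [forall i : 'I_(size r), sumn (U i) == nth 0%N r i])
      gam g n (concat U).
Proof.
move=> q0 sq sr; apply/ffunP=> s.
rewrite (@mulXi _ _ _ _ (gw g q) _ _ erefl sr (gamE g q)) galg_sumE.
have szs : size (one_line s) = sumn r by rewrite size_one_line sr.
have szb i := size_blk (erefl (size r)) szs i.
have dB := @disjoint_blk (size r) _ _ szs (uniq_one_line s).
rewrite -{1}sq shsum_gw ?(sum_size_blk _ szs) ?sr //.
apply: eq_big => [U | U /forallP sU]; first by apply: eq_forallb => i; rewrite szb.
rewrite gamE gw_concat ?concat_blk // => i.
exact/eqP.
Qed.


Lemma gam_nonzero_parts (k : nat) (r : seq nat) (U : {ffun 'I_k -> seq nat}) :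
    size r = k -> 0%N \notin r -> (forall i : 'I_k, sumn (U i) = nth 0%N r i) ->
  forall i, (0 < size (U i))%N.
Proof.
move=> szr r0 sU i; have := sU i; case: (U i) => //= ri0; case/negP: r0.
by rewrite ri0; apply: mem_nth; rewrite szr.
Qed.

Lemma size_concat k (U : {ffun 'I_k -> seq nat}) :
  size (concat U) = (\sum_i size (U i))%N.
Proof. by rewrite -count_predT count_concat; apply: eq_bigr => i _; rewrite count_predT. Qed.

Lemma concat_singletons k (r : seq nat) (U : {ffun 'I_k -> seq nat}) : size r = k ->
  (forall i : 'I_k, U i = [:: nth 0%N r i]) -> concat U = r.
Proof.
move=> szr Ur; rewrite /concat (eq_map Ur) -[RHS](mkseq_nth 0%N) /mkseq szr.
by rewrite -val_enum_ord -map_comp; elim: (enum _) => //= i s ->.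
Qed.

Lemma mulXi_gam_span n (r q : seq nat) : 0%N \notin q -> sumn q = n -> sumn r = n ->
  exists s : seq (seq nat), all (perm_eq q) s /\
    Xi K (wset n r) * gam g n q = \sum_(v <- s) gam g n v.
Proof.
move=> q0 sq sr; rewrite mulXi_gam // -big_filter.
set s := filter _ _; exists [seq concat U | U <- s]; split; last by rewrite big_map.
apply/allP=> _ /mapP[U + ->]; rewrite mem_filter perm_sym => /andP[_].
exact: perm_distributions.
Qed.

(** Each part of [r] is positive and needs a letter of [q], so no distribution is admissible. *)
Lemma mulXi_gam0 n (r q : seq nat) : 0%N \notin q -> 0%N \notin r -> sumn q = n ->
  sumn r = n -> (size q < size r)%N -> Xi K (wset n r) * gam g n q = 0.
Proof.
move=> q0 r0 sq sr szqr; rewrite mulXi_gam // big_seq_cond big1 // => U.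
case/andP=> /perm_distributions/perm_size szU /forallP sU.
have: (\sum_(i < size r) 1 <= \sum_i size (U i))%N.
  apply: leq_sum => i _; apply: (gam_nonzero_parts erefl r0) => j; exact/eqP.
by rewrite -size_concat szU sum1_card card_ord leqNgt szqr.
Qed.

(** As [r] and [q] have equally many letters, each [U i] is the single letter r_i and every term is
    g_r. So [N] counts the admissible distributions, and there is one because [q] has the letters of
    [r]. *)
Lemma mulXi_gam_perm n (r q : seq nat) : 0%N \notin q -> sumn q = n -> perm_eq r q ->
  exists2 N : nat, (0 < N)%N & Xi K (wset n r) * gam g n q = N%:R *: gam g n r.
Proof.
move=> q0 sq rq; have sr : sumn r = n.
  by rewrite -sq !sumnE; apply: perm_big.
have r0 : 0%N \notin r by rewrite (perm_mem rq).
rewrite mulXi_gam //.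
pose P (U : {ffun 'I_(size r) -> seq nat}) := [forall i, sumn (U i) == nth 0%N r i].
exists (count P (distributions (size r) q)).
  rewrite -has_count; apply/hasP; pose U : {ffun 'I_(size r) -> seq nat} :=
    [ffun i : 'I_(size r) => [:: nth 0%N r i]].
  have cU : concat U = r by apply: concat_singletons => // i; rewrite ffunE.
  exists U; last by apply/forallP=> i; rewrite ffunE /= addn0.
  by apply: mem_distributions_single; [move=> i; rewrite ffunE | rewrite cU].
rewrite -big_filter (eq_big_seq (fun=> gam g n r)) => [|U].
  by rewrite big_const_seq iter_addr addr0 count_predT size_filter scaler_nat.
rewrite mem_filter => /andP[/forallP sU /perm_distributions pU]; congr gam.
apply: concat_singletons => // i.
have szU : (\sum_i size (U i) = \sum_(i < size r) 1)%N.
  by rewrite -size_concat (perm_size pU) -(perm_size rq) sum1_card card_ord.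
have U0 j : (0 < size (U j))%N.
  by apply: (gam_nonzero_parts erefl r0) => l; apply/eqP.
have szi : size (U i) = 1%N.
  apply/eqP; rewrite eqn_leq U0 andbT leqNgt; apply/negP => Ui.
  have: (\sum_(j < size r) 1 < \sum_j size (U j))%N.
    rewrite (bigD1 i) //= [X in (_ < X)%N](bigD1 i) //= -addSn; apply: leq_add => //.
    exact: leq_sum.
  by rewrite szU ltnn.
by have /eqP := sU i; case: (U i) szi => [|x []] //= _; rewrite addn0 => ->.
Qed.

End Lie.

(** * Lie series are Lie functionals *)

Section OmegaFun.

Lemma scanl_nseq1 a k : scanl addn a (nseq k 1%N) = iota a.+1 k.
Proof. by elim: k a => //= k IHk a; rewrite addn1 IHk. Qed.

Lemma wset_hook n k : (k < n)%N ->
  wset n (rcons (nseq k 1%N) (n - k)%N) = [set i : 'I_n.-1 | (i < k)%N].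
Proof.
move=> kn; apply/setP=> i; rewrite !inE -cats1 mem_scanl_cat //.
have sk : sumn (nseq k 1%N) = k by rewrite sumn_nseq mul1n.
rewrite sk scanl_nseq1 mem_iota add1n; case: (ltnP i k) => ik.
  by apply/orP; right; lia.
by rewrite /= inE; have := ltn_ord i; apply/contraTF => /eqP; lia.
Qed.

(** The descents of [w] are exactly its first [k] positions, as prescribed by the composition
    1^k.(n-k). *)
Definition hook_des (w : seq nat) k : bool :=
  all (fun i => (nth 0 w i.+1 < nth 0 w i)%N == (i < k)%N) (iota 0 (size w).-1).

Lemma hook_des_cons x y w k :
  hook_des [:: x, y & w] k = ((y < x)%N == (0 < k)%N) && hook_des (y :: w) k.-1.
Proof.
rewrite /hook_des /= -[1%N]addn0 iotaDl all_map; congr (_ && _).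
by apply: eq_all => i /=; case: k.
Qed.

Lemma hook_des0 (w : seq nat) : uniq w -> hook_des w 0 = sorted ltn w.
Proof.
move=> uw; rewrite -sorted_leq_uniq //; apply/allP/(sortedP 0%N) => srt i.
  move=> iw; have mi : i \in iota 0 (size w).-1 by rewrite mem_iota; lia.
  by rewrite leqNgt (eqP (srt i mi)).
by rewrite mem_iota ltn0 => iw; rewrite ltnNge srt //; lia.
Qed.

Lemma omega_word_hook (R : comNzRingType) (w : seq nat) : uniq w ->
  \sum_(k < size w) (-1) ^+ k * (hook_des w k)%:R = omega_word R w.
Proof.
elim: w => [|x w IHw]; first by rewrite big_ord0.
case: w IHw => [|y w] IHw uw; first by rewrite big_ord1 /= mulr1.
have {}IHw := IHw (subseq_uniq (subseq_cons _ _) uw).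
rewrite omega_word_cons2 -IHw big_ord_recl /=.
under eq_bigr do rewrite hook_des_cons /= exprS.
rewrite hook_des_cons /= expr0 mul1r; case: ltnP => yx /=.
  by rewrite add0r -sumrN; apply: eq_bigr => i _; rewrite mulN1r mulNr.
rewrite big1 ?addr0 => [|i _]; last by rewrite mulr0.
by rewrite hook_des0 //; case/andP: uw.
Qed.

Lemma omegaE (K : fieldType) n (s : 'S_n) :
  (omega K n : {ffun _ -> _}) s = omega_word K (one_line s).
Proof.
rewrite -omega_word_hook ?uniq_one_line // size_one_line galg_sumE; apply: eq_bigr => k _.
rewrite galg_scaleE class_sumE wset_hook //; congr (_ * (nat_of_bool _)%:R).
apply/eqP/allP => [desE i | desE].
  rewrite mem_iota size_one_line add0n => /andP[_ i_n].
  by move/setP/(_ (Ordinal i_n)): desE; rewrite !inE => ->.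
apply/setP=> i; rewrite !inE; apply: (eqP (desE i _)).
by rewrite mem_iota size_one_line add0n leq0n ltn_ord.
Qed.

Lemma mulXi_omega (K : fieldType) n (r : seq nat) i j : sumn r = n ->
    i != j -> (0 < nth 0%N r i)%N -> (0 < nth 0%N r j)%N ->
  Xi K (wset n r) * omega K n = 0.
Proof.
move=> sr ij ri rj; apply/ffunP=> s.
have ltr l : (0 < nth 0%N r l)%N -> (l < size r)%N.
  by rewrite [(l < _)%N]ltnNge; apply: contraTN => rl; rewrite nth_default.
have szs : size (one_line s) = sumn r by rewrite size_one_line sr.
have szb := size_blk (erefl (size r)) szs.
rewrite (@mulXi _ _ _ _ (omega_word K) _ _ erefl sr (@omegaE _ _)) [RHS]ffunE.
apply: (@lie_omega_word K _ _ _ (Ordinal (ltr _ ri)) (Ordinal (ltr _ rj))) => //.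
- by apply: disjoint_blk => //; apply: uniq_one_line.
- by rewrite sum_size_blk.
- by rewrite -size_eq0 szb /= -lt0n.
- by rewrite -size_eq0 szb /= -lt0n.
Qed.

End OmegaFun.

(** * From annihilation by [Xi] to vanishing on all proper shuffles *)

Section Standardization.

Lemma uniq_concat k (B : {ffun 'I_k -> seq nat}) : disjoint_blocks B -> uniq (concat B).
Proof.
case=> uB dB; rewrite /concat; have := enum_uniq 'I_k.
elim: (enum 'I_k) => //= i s IHs /andP[is_ us]; rewrite cat_uniq uB IHs // andbT.
apply/hasPn => x /flattenP[b /mapP[j js ->] xj]; apply/negP => xi.
by case/negP: is_; rewrite (dB _ _ _ xi xj).
Qed.

Lemma shsum_map (R : comNzRingType) k n (B : {ffun 'I_k -> seq nat}) (f : nat -> nat)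
    (h : seq nat -> R) :
  shsum n [ffun i => map f (B i)] (fun v _ => h v) =
    shsum n B (fun v _ => h (map f v)).
Proof.
elim: n B h => [|n IHn] B h //=; apply: eq_big => [i | i].
  by rewrite ffunE; case: (B i).
rewrite ffunE => Bi.
have -> : pop [ffun i => map f (B i)] i = [ffun j => map f (pop B i j)].
  by apply/ffunP=> j; rewrite !ffunE; case: eqP => _ //; rewrite -!drop1 map_drop.
by rewrite IHn; case: (B i) Bi.
Qed.

(** By [mulXi] the hypothesis is the vanishing on shuffles of blocks cut from a permutation; other
    blocks are standardized first, which keeps all descents. Empty blocks give zero entries of [r],
    so the hypothesis asks for two positive entries and not for length at least 2. *)
Lemma lie_annihilated (K : fieldType) m (f : 'KS[K]_m) k : f \in descent_alg K m ->
    (forall (r : seq nat) i j, sumn r = m -> i != j ->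
      (0 < nth 0%N r i)%N -> (0 < nth 0%N r j)%N -> Xi K (wset m r) * f = 0) ->
  lie_functional k m (lv f).
Proof.
move=> fD f0 B i j dB szB ij Bi Bj; set w := concat B.
have uw : uniq w := uniq_concat dB.
have szw : size w = m by rewrite size_concat.
(* The standardization: [rk] renames the letters of [w] to 0, ..., m-1 in the same order, so that
   [map rk w] is the word of a permutation. *)
pose rk x := count (fun y => y < x)%N w.
have rk_lt x y : x \in w -> (x < y)%N -> (rk x < rk y)%N.
  move=> xw xy; rewrite /rk -!sum1_count.
  rewrite [X in (_ < X)%N](bigID (fun z => z < x)%N) /= -addn1 leq_add //.
    rewrite leq_eqVlt; apply/orP; left; apply/eqP; apply: eq_bigl => z.
    by case: (ltnP z x) => zx; rewrite ?andbF // (ltn_trans zx xy).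
  by rewrite (big_rem x) //= xy ltnn.
have rk_mono : {in w &, forall x y, (rk x < rk y)%N = (x < y)%N}.
  move=> x y xw yw; case: (ltngtP x y) => [|yx|->]; [exact: rk_lt| |by rewrite ltnn].
  by rewrite ltnNge ltnW ?rk_lt.
have rk_inj : {in w &, injective rk}.
  by move=> x y xw yw eqr; case: (ltngtP x y) => //; rewrite -rk_mono // eqr ltnn.
have [|||s sE] := @one_line_surj m (map rk w).
- by rewrite map_inj_in_uniq.
- by rewrite size_map.
- apply/allP=> _ /mapP[x xw ->]; rewrite -szw /rk -(count_predC (fun y => y < x)%N).
  by rewrite -addn1 leq_add2l -has_count; apply/hasP; exists x; rewrite //= ltnn.
pose r := [seq size (B l) | l <- enum 'I_k].
have nr (l : 'I_k) : nth 0%N r l = size (B l).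
  by rewrite (nth_map l) ?size_enum_ord // nth_ord_enum.
have sr : sumn r = m by rewrite -szB sumnE big_map big_enum.
have szr : size r = k by rewrite size_map size_enum_ord.
have := f0 r i j sr ij; rewrite !nr !lt0n !size_eq0 => /(_ Bi Bj)/ffunP/(_ s).
have fE t : (f : {ffun _ -> _}) t = lv f (one_line t) by rewrite lv_one_line.
rewrite (@mulXi _ _ _ _ (lv f) _ _ szr sr fE) [RHS]ffunE => <-; rewrite sE.
have -> : blk k r (map rk w) = [ffun l => map rk (B l)].
  apply/ffunP=> l; rewrite !ffunE reshape_map /w /concat /r.
  have -> : [seq size (B l) | l <- enum 'I_k] = shape [seq B l | l <- enum 'I_k].
    by rewrite /shape -map_comp.
  rewrite flattenK -map_comp (nth_map l) ?size_enum_ord //=.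
  by rewrite (nth_ord_enum _ l).
rewrite shsum_map; apply: eq_shsum => v c szv _ _ memv.
suff eqd : wdes m (map rk v) = wdes m v by rewrite /lv eqd.
apply/setP=> l; rewrite !inE.
have l1 : (l.+1 < size v)%N by have := ltn_ord l; lia.
rewrite (nth_map 0%N _ _ l1) (nth_map 0%N _ _ (ltnW l1)) rk_mono //.
  have /memv[l' xl] := mem_nth 0%N l1.
  by apply/flattenP; exists (B l'); rewrite ?map_f ?mem_enum.
have /memv[l' xl] := mem_nth 0%N (ltnW l1).
by apply/flattenP; exists (B l'); rewrite ?map_f ?mem_enum.
Qed.

Section LieSeries.
Variables (K : fieldType) (g : forall m, 'KS[K]_m).
Hypotheses (charK : [pchar K] =i pred0) (g_lie : lie_series g).

(** The equality of right ideals gives g_m = m [omega] a for some a, and [Xi] already annihilates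
    [omega]. *)
Lemma lie_series_mulXi m (r : seq nat) i j : (0 < m)%N -> sumn r = m ->
    i != j -> (0 < nth 0%N r i)%N -> (0 < nth 0%N r j)%N ->
  Xi K (wset m r) * g m = 0.
Proof.
move=> m0 sr ij ri rj; have [_ [_ eqL]] := g_lie m0.
have: amull (m%:R^-1 *: g m) 1 \in (amull (m%:R^-1 *: g m) @: fullv)%VS.
  by rewrite memv_img ?memvf.
rewrite eqL => /memv_imgP[a _]; rewrite !lfunE /= mulr1 => gE.
have m_neq0 : m%:R != 0 :> K by rewrite ((pcharf0P K).1 charK) -lt0n.
have -> : g m = m%:R *: (omega K m * a) by rewrite -gE scalerA divff // scale1r.
by rewrite -scalerAr mulrA (mulXi_omega _ sr ij) // mul0r scaler0.
Qed.

Lemma lie_series_functional k m : (0 < m)%N -> lie_functional k m (lv (g m)).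
Proof.
move=> m0; apply: lie_annihilated; first by have [] := g_lie m0.
by move=> r i j; apply: lie_series_mulXi.
Qed.

End LieSeries.
End Standardization.

(** * Compositions and triangularity *)

Lemma path_scanl a (q : seq nat) : path ltn a (scanl addn a q) = (0%N \notin q).
Proof.
elim: q a => //= b q IHq a; rewrite IHq inE negb_or; congr (_ && _).
by rewrite -[X in (X < _)%N]addn0 ltn_add2l lt0n eq_sym.
Qed.

Lemma scanl_inj (q q' : seq nat) : scanl addn 0%N q = scanl addn 0%N q' -> q = q'.
Proof. exact: (can_inj (scanlK (f := fun x y => (y - x)%N) addKn 0%N)). Qed.

Lemma setw_gt0 n (D : {set 'I_n.-1}) : 0%N \notin setw D.
Proof.
case: n D => // n D; rewrite -(path_scanl 0) scanl_setw // rcons_path.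
rewrite path_min_sorted; last by apply/allP=> _ /mapP[j _ ->].
apply/andP; split.
  rewrite sorted_map /enum_mem; apply: sorted_filter.
    by move=> i j l; apply: ltn_trans.
  by rewrite -enumT; have := iota_ltn_sorted 0 n; rewrite -val_enum_ord sorted_map.
have : all (fun i => i <= n)%N (0%N :: [seq (val i).+1 | i <- enum D]).
  by rewrite /=; apply/allP=> _ /mapP[j _ ->]; apply: ltn_ord.
by move=> /allP/(_ _ (mem_last _ _)).
Qed.

Lemma setw_wset n (q : seq nat) : 0%N \notin q -> sumn q = n -> setw (wset n q) = q.
Proof.
move=> q0 sq; case: (posnP n) => [n0|n0].
  move: q q0 sq; rewrite n0 => -[|a q] //=; rewrite inE negb_or => /andP[a0 _] sq.
  by move: a0; case: a sq.
apply: scanl_inj; rewrite scanl_setw //.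
have srt (u : seq nat) : 0%N \notin u -> sorted ltn (scanl addn 0%N u).
  by rewrite -(path_scanl 0); apply: path_sorted.
apply: (irr_sorted_eq ltn_trans ltnn).
- by rewrite -scanl_setw //; apply/srt/setw_gt0.
- exact: srt.
move=> x; rewrite mem_rcons inE; have [->|x0] := posnP x.
  rewrite (ltn_eqF n0) /=; apply/idP/idP => [/mapP[]//|].
  move: q0; rewrite -(path_scanl 0) path_sortedE; last exact: ltn_trans.
  by case/andP=> /allP/(_ 0%N) /[swap] _ /[apply].
case: (ltngtP x n) => [xn|nx|->] /=; last by rewrite -sq sumn_mem_scanl // sq.
  by rewrite -mem_wset // x0.
apply/idP/idP => [/mapP[i _ xE]|/mem_scanl_le]; last by rewrite sq leqNgt nx.
by move: nx; rewrite xE => nx; have := ltn_ord i; lia.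
Qed.

Lemma size_setw n (D : {set 'I_n.-1}) : (0 < n)%N -> size (setw D) = #|D|.+1.
Proof.
move=> n0; have := congr1 size (scanl_setw D n0).
by rewrite size_scanl size_rcons size_map -cardE.
Qed.

Lemma wset1 n : wset n [:: n] = set0.
Proof.
by apply/setP=> i; rewrite !inE add0n; apply/negbTE; have := ltn_ord i; lia.
Qed.

(** The identity is the only permutation without descents. In terms of shuffles, a single block has
    only itself as a shuffle. *)
Lemma Xi_set0_mul (K : fieldType) n (f : 'KS[K]_n) : f \in descent_alg K n ->
  Xi K set0 * f = f.
Proof.
move=> fD; apply/ffunP=> s; rewrite -wset1.
have sn : sumn [:: n] = n by rewrite /= addn0.
have szs : size (one_line s) = sumn [:: n] by rewrite sn size_one_line.
rewrite (@mulXi K n 1 [:: n] (lv f) f s erefl sn) => [|t]; last by rewrite lv_one_line.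
rewrite (@shsum_single _ _ _ _ ord0) => [|j|].
- by rewrite ffunE /= take_oversize ?lv_one_line // size_one_line.
- by rewrite (ord1 j).
- by rewrite (@size_blk 1 [:: n] _ erefl szs).
Qed.

(** * Descent sets of concatenated compositions *)

Section Join.
Variables m n : nat.
Implicit Types (D : {set 'I_m.-1}) (E : {set 'I_n.-1}).

Definition jw D E : {set 'I_(m + n).-1} := wset (m + n) (setw D ++ setw E).

Lemma mem_setw p (D : {set 'I_p.-1}) (i : 'I_p.-1) :
  (i \in D) = (i.+1 \in scanl addn 0%N (setw D)).
Proof. by rewrite -[in LHS](setwK D) inE. Qed.

Lemma mem_jwl D E i (im : (i < m.-1)%N) (imn : (i < (m + n).-1)%N) :
  (Ordinal imn \in jw D E) = (Ordinal im \in D).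
Proof.
have lt_m : (i.+1 < m)%N by lia.
by rewrite inE mem_setw mem_scanl_cat // sumn_setw /= (ltnW lt_m) (ltn_eqF lt_m).
Qed.

Lemma mem_jwr D E i (i_n : (i < n.-1)%N) (imn : (m + i < (m + n).-1)%N) :
  (Ordinal imn \in jw D E) = (Ordinal i_n \in E).
Proof.
rewrite inE mem_setw mem_scanl_cat // sumn_setw /= -addnS addKn.
by rewrite leqNgt -addSnnS leq_addr.
Qed.

(** Both sides agree at the junction [m]; elsewhere they are [D], [D'] and the shifted [E], [E']. *)
Lemma jw_sub D E D' E' : (jw D E \subset jw D' E') = (D \subset D') && (E \subset E').
Proof.
apply/subsetP/andP => [sub | [/subsetP DD' /subsetP EE'] [i imn]].
  split; apply/subsetP=> -[i ilt] iD.
    have imn : (i < (m + n).-1)%N by lia.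
    by rewrite -(mem_jwl D' E' ilt imn) sub // mem_jwl.
  have imn : (m + i < (m + n).-1)%N by lia.
  by rewrite -(mem_jwr D' E' ilt imn) sub // mem_jwr.
rewrite !inE !mem_scanl_cat // !sumn_setw /=.
case: (ltngtP i.+1 m) => [im | mi | eqm] //=.
  have im' : (i < m.-1)%N by lia.
  have := DD' (Ordinal im'); rewrite !mem_setw /=; exact.
have im' : (i - m < n.-1)%N by lia.
have := EE' (Ordinal im'); rewrite !mem_setw /= subSn //; exact.
Qed.

Lemma jw_inj D E D' E' : jw D E = jw D' E' -> D = D' /\ E = E'.
Proof.
move/eqP; rewrite eqEsubset !jw_sub => /andP[/andP[d e] /andP[d' e']].
by split; apply/eqP; rewrite eqEsubset ?d ?e.
Qed.

End Join.

Lemma Xi_coord_outer (K : fieldType) m n (x : 'KS[K]_m) (y : 'KS[K]_n) F :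
  Xi_coord F (outer x y) =
    \sum_D \sum_E Xi_coord D x * Xi_coord E y * (jw D E == F)%:R.
Proof.
rewrite /outer Xi_coord_sum; apply: eq_bigr => D _.
rewrite Xi_coord_sum; apply: eq_bigr => E _.
by rewrite Xi_coordZ Xi_coordE eq_sym.
Qed.

Lemma Xi_coord_outer_jw (K : fieldType) m n (x : 'KS[K]_m) (y : 'KS[K]_n) D E :
  Xi_coord (jw D E) (outer x y) = Xi_coord D x * Xi_coord E y.
Proof.
rewrite Xi_coord_outer (bigD1 D) //= (bigD1 E) //= eqxx mulr1.
rewrite [X in _ + X + _]big1 => [|E' /negPf EE']; last first.
  by case: eqP => [/jw_inj[_ /eqP]|]; rewrite ?EE' ?mulr0.
rewrite big1 ?addr0 // => D' /negPf DD'; apply: big1 => E' _.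
by case: eqP => [/jw_inj[/eqP]|]; rewrite ?DD' ?mulr0.
Qed.

Lemma Xi_coord_outer_neq0 (K : fieldType) m n (x : 'KS[K]_m) (y : 'KS[K]_n) F :
  Xi_coord F (outer x y) != 0 -> exists D E,
    [/\ Xi_coord D x != 0, Xi_coord E y != 0 & jw D E = F].
Proof.
move=> F0; have /existsP[D /existsP[E /and3P[xD yE /eqP eF]]] :
    [exists D, exists E, [&& Xi_coord D x != 0, Xi_coord E y != 0 & jw D E == F]].
  apply: contraNT F0; rewrite negb_exists => /forallP noD.
  rewrite Xi_coord_outer big1 // => D _; apply: big1 => E _.
  have := noD D; rewrite negb_exists => /forallP/(_ E).
  by rewrite !negb_and !negbK => /or3P[/eqP->|/eqP->|/negPf->]; rewrite ?mulr0 ?mul0r.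
by exists D, E.
Qed.

(** * Triangularity of the g_q with respect to the Xi^q *)

Section Triangular.
Variables (K : fieldType) (g : forall m, 'KS[K]_m).
Hypotheses (charK : [pchar K] =i pred0) (g_lie : lie_series g).

Lemma lie_series_descent m : (0 < m)%N -> g m \in descent_alg K m.
Proof. by case/g_lie. Qed.

(** If [D] is nonempty, then its composition has at least two parts and [Xi K D] annihilates g_m;
    only the identity survives. *)
Lemma lie_series_mul m (f : 'KS[K]_m) : (0 < m)%N -> f \in descent_alg K m ->
  f * g m = Xi_coord set0 f *: g m.
Proof.
move=> m0 fD; rewrite {1}(Xi_expand fD) mulr_suml (bigD1 set0) //=.
rewrite -scalerAl Xi_set0_mul ?lie_series_descent // big1 ?addr0 // => D D0.
rewrite -scalerAl -(setwK D).
have szD : (1 < size (setw D))%N by rewrite size_setw // ltnS card_gt0.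
have pos i : (i < size (setw D))%N -> (0 < nth 0%N (setw D) i)%N.
  move=> iD; rewrite lt0n; apply: contraNneq (setw_gt0 D) => <-; exact: mem_nth.
rewrite (@lie_series_mulXi _ _ charK g_lie _ _ 0 1) ?scaler0 ?sumn_setw //; apply: pos => //.
exact: ltnW.
Qed.

(** If the coefficient were 0, then g_m * g_m = 0 by [lie_series_mul], so the idempotent would be 0.
    But it generates the same right ideal as [omega], whose value at the identity is 1. *)
Lemma Xi_coord_lie_series m : (0 < m)%N -> Xi_coord set0 (g m) != 0.
Proof.
move=> m0; have [gD [idem eqL]] := g_lie m0.
have om0 : omega K m != 0.
  apply/eqP=> /ffunP/(_ 1%g); rewrite omegaE [RHS]ffunE.
  have -> : one_line (1 : 'S_m)%g = iota 0 m.
    by rewrite /one_line -val_enum_ord; apply: eq_map => i; rewrite perm1.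
  case: (m) m0 => // -[|p] _ /=; first by move/eqP; rewrite oner_eq0.
  rewrite (_ : path _ _ _) //; first by move/eqP; rewrite oner_eq0.
  exact: iota_ltn_sorted 1 p.+1.
apply: contra_neq om0 => c0.
have g0 : m%:R^-1 *: g m = 0.
  by rewrite -idem -scalerAl -scalerAr lie_series_mul // c0 scale0r !scaler0.
have: amull (omega K m) 1 \in (amull (omega K m) @: fullv)%VS.
  by rewrite memv_img ?memvf.
by rewrite -eqL g0 => /memv_imgP[a _]; rewrite !lfunE /= mulr1 mul0r.
Qed.

(** The coordinates of an outer product multiply along [jw], and prepending the letter [a] joins the
    empty set in front, which is contained in every set. *)
Lemma outer_word_triangular q : 0%N \notin q ->
  (forall F, Xi_coord F (outer_word g q) != 0 -> wset (sumn q) q \subset F) /\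
  Xi_coord (wset (sumn q) q) (outer_word g q) != 0.
Proof.
elim: q => [_|a q IHq] /=.
  have allE (D E : {set 'I_0}) : D = E by apply/setP=> -[].
  split=> [F _|]; first by rewrite (allE F (wset 0 [::])).
  apply: contraTneq (oner_neq0 ('KS[K]_0 : nzRingType)) => c0.
  have -> : (1 : 'KS[K]_0) = \sum_D Xi_coord D 1 *: Xi K D.
    exact: (Xi_expand (outer_word_descent g [::])).
  by rewrite big1 ?eqxx // => D _; rewrite (allE D (wset 0 [::])) c0 scale0r.
rewrite inE negb_or eq_sym -lt0n => /andP[a0 /IHq[tri diag]].
have -> : wset (a + sumn q) (a :: q) = jw (set0 : {set 'I_a.-1}) (wset (sumn q) q).
  rewrite -[a :: q]/([:: a] ++ q); apply: wset_cat; rewrite ?sumn_setw ?setwK ?wset1 //.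
  by rewrite /= addn0.
split=> [F /Xi_coord_outer_neq0[D [E [_ /tri WE <-]]]|].
  by rewrite jw_sub sub0set.
by rewrite Xi_coord_outer_jw mulf_neq0 // Xi_coord_lie_series.
Qed.

Lemma gam_triangular n q : 0%N \notin q -> sumn q = n ->
  (forall F, Xi_coord F (gam g n q) != 0 -> wset n q \subset F) /\
  Xi_coord (wset n q) (gam g n q) != 0.
Proof.
move=> q0 e; rewrite -(gam_outer_word lie_series_descent e q0); case: n / e => /=.
exact: outer_word_triangular.
Qed.

End Triangular.

(** * Peak sets and odd compositions *)

(* Bit i of b says whether i + 2 is a peak.  A peak at i is the domino covering  *)
(* i and i + 1; the odd composition is read off the tiling of 2, ..., n by       *)
(* dominoes and squares, a square starting a new part and a domino adding 2 to   *)
(* the current part c.                                                           *)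
Fixpoint tiling_word (c : nat) (b : seq bool) : seq nat :=
  match b with
  | [::] => [:: c]
  | false :: b' => c :: tiling_word 1 b'
  | true :: b' => if b' is _ :: b'' then tiling_word c.+2 b'' else [:: c]
  end.

(** No two peaks are adjacent and [n] is not a peak: this lets every [true] start a domino whose
    second cell holds [false]. *)
Definition sparse (b : seq bool) : bool :=
  sorted (fun x y => ~~ (x && y)) b && ~~ last false b.

Lemma sparse_cons x b : sparse (x :: b) -> sparse b.
Proof. by rewrite /sparse; case: b => //= y b /andP[/andP[_ ->]]. Qed.

Lemma sparse_ind (P : seq bool -> Prop) :
    P [::] -> (forall b, sparse b -> P b -> P (false :: b)) ->
    (forall b, sparse b -> P b -> P [:: true, false & b]) ->
  forall b, sparse b -> P b.
Proof.
move=> P0 PF PTF b; have [m] := ubnP (size b); elim: m b => // m IHm [|[] b] //.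
  case: b => [|[] b] //= szb sb; have sb' := sparse_cons (sparse_cons sb).
  by apply: PTF => //; apply: IHm => //; apply: ltnW.
by move=> szb /sparse_cons sb; apply: PF => //; apply: IHm.
Qed.

Lemma sumn_tiling_word c b : sparse b -> sumn (tiling_word c b) = (c + size b)%N.
Proof.
move=> sb; elim/sparse_ind: b / sb c => [|b _ IHb|b _ IHb] c /=.
- by rewrite addn0.
- by rewrite IHb add1n.
- by rewrite IHb; lia.
Qed.

Lemma odd_tiling_word c b : sparse b -> odd c -> all odd (tiling_word c b).
Proof.
move=> sb; elim/sparse_ind: b / sb c => [|b _ IHb|b _ IHb] c oc /=.
- by rewrite oc.
- by rewrite oc IHb.
- by rewrite IHb //= negbK.
Qed.

Lemma head_tiling_word c b : sparse b -> (c <= head 0 (tiling_word c b))%N.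
Proof.
move=> sb; elim/sparse_ind: b / sb c => //= b _ IHb c.
by apply: leq_trans (IHb _); lia.
Qed.

(** The first part reveals the first tile: it is [c] after a square and at least [c.+2] after a
    domino. *)
Lemma tiling_word_inj c b b' : sparse b -> sparse b' -> size b = size b' ->
  tiling_word c b = tiling_word c b' -> b = b'.
Proof.
move=> sb; elim/sparse_ind: b / sb b' c => [|b sb IHb|b sb IHb] b' c sb'.
- by case: b' sb'.
- elim/sparse_ind: b' / sb' => [|b' sb' _|b' sb' _] //=.
    by move=> [szb] [/(IHb _ _ sb' szb)->].
  by move=> _ eqt; have := head_tiling_word c.+2 sb'; rewrite -eqt /= ltnNge ltnW.
elim/sparse_ind: b' / sb' => [|b' sb' _|b' sb' _] //=.
  by move=> _ eqt; have := head_tiling_word c.+2 sb; rewrite eqt /= ltnNge ltnW.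
by move=> [szb] /(IHb _ _ sb' szb)->.
Qed.

Section PeakCount.
Variable n : nat.
Hypothesis n_gt0 : (0 < n)%N.

(** The appended bit stands for the position [n]; [take] has an effect only for [n = 1], where no
    position is left to tile. *)
Definition peak_bits (P : {set 'I_n.-2}) : seq bool :=
  take n.-1 (rcons [seq i \in P | i <- enum 'I_n.-2] false).

Lemma size_peak_bits P : size (peak_bits P) = n.-1.
Proof. by rewrite size_takel // size_rcons size_map size_enum_ord; lia. Qed.

Lemma nth_peak_bits P (i : 'I_n.-2) : nth false (peak_bits P) i = (i \in P).
Proof.
rewrite nth_take; last by have := ltn_ord i; lia.
by rewrite nth_rcons size_map size_enum_ord ltn_ord (nth_map i) ?size_enum_ord // nth_ord_enum.
Qed.

Lemma nth_peak_bits_out P j : (n.-2 <= j)%N -> nth false (peak_bits P) j = false.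
Proof.
move=> nj; case: (ltnP j n.-1) => jn; last by rewrite nth_default ?size_peak_bits.
rewrite nth_take // nth_rcons size_map size_enum_ord ltnNge nj /=.
by case: ifP.
Qed.

Lemma peak_bits_inj : injective peak_bits.
Proof. by move=> P Q PQ; apply/setP=> i; rewrite -!nth_peak_bits PQ. Qed.

Lemma sparse_peak_bits (s : 'S_n) : sparse (peak_bits (Peak s)).
Proof.
apply/andP; split; last first.
  by rewrite -nth_last size_peak_bits nth_peak_bits_out.
apply/(sortedP false) => j _; case: (ltnP j.+1 n.-2) => jn; last first.
  by rewrite (nth_peak_bits_out _ jn) andbF.
have jn' := ltnW jn; rewrite -[j.+1]/(val (Ordinal jn)) -[X in nth _ _ X && _]/(val (Ordinal jn')).
rewrite !nth_peak_bits !inE /= negb_and; apply/orP.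
case: (ltnP (nth 0 (one_line s) j.+1) (nth 0 (one_line s) j.+2))%N => lt12; [left|by right].
by rewrite negb_and orbC -leqNgt ltnW.
Qed.

Definition odd_set : {set {set 'I_n.-1}} := [set D | all odd (setw D)].

Lemma card_peak_sets : (#|[set Peak s | s : 'S_n]| <= #|odd_set|)%N.
Proof.
(* The initial 1 accounts for position 1, which no tile covers. *)
pose f P := wset n (tiling_word 1 (peak_bits P)).
have sumf s : sumn (tiling_word 1 (peak_bits (Peak s))) = n.
  by rewrite sumn_tiling_word ?sparse_peak_bits // size_peak_bits add1n prednK.
have oddf s : all odd (tiling_word 1 (peak_bits (Peak s))).
  exact/odd_tiling_word/isT/sparse_peak_bits.
have setwf s : setw (f (Peak s)) = tiling_word 1 (peak_bits (Peak s)).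
  by apply: setw_wset => //; apply/negP => /(allP (oddf s)).
rewrite -(@card_in_imset _ _ f) => [|_ _ /imsetP[s _ ->] /imsetP[t _ ->]].
  by apply/subset_leq_card/subsetP => _ /imsetP[_ /imsetP[s _ ->] ->]; rewrite inE setwf.
move/(congr1 (@setw n)); rewrite !setwf => /tiling_word_inj eqb.
by apply/peak_bits_inj/eqb; rewrite ?sparse_peak_bits ?size_peak_bits.
Qed.

(** [Pi K P] is 0 unless [P] is the peak set of a permutation, so only these sets contribute to the
    span. *)
Lemma dim_peak_alg (K : fieldType) : (\dim (peak_alg K n) <= #|odd_set|)%N.
Proof.
apply: leq_trans card_peak_sets; set S := [set _ | _ : _].
apply: (@leq_trans (\dim <<[seq Pi K P | P in S]>>)).
  apply/dimvS/span_subvP => _ /imageP[P _ ->]; case: (boolP (P \in S)) => PS.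
    by apply/memv_span/imageP; exists P.
  rewrite /Pi big1 ?mem0v // => s /eqP sP; case/negP: PS.
  by apply/imsetP; exists s.
by apply: leq_trans (dim_span _) _; rewrite size_image.
Qed.

End PeakCount.

(** * The decomposition *)

Section Decomposition.
Variables (K : fieldType) (g : forall m, 'KS[K]_m).
Hypotheses (charK : [pchar K] =i pred0) (g_lie : lie_series g).
Variable n : nat.
Hypothesis n_gt0 : (0 < n)%N.
Implicit Types (D E F : {set 'I_n.-1}) (A : {set {set 'I_n.-1}}) (p : partition_of n).

Let g_lief k m (m0 : (0 < m)%N) : lie_functional k m (lv (g m)) :=
  lie_series_functional charK g_lie (k := k) m0.

Definition gamD D : 'KS[K]_n := gam g n (setw D).

Definition gam_span A : {vspace 'KS[K]_n} := <<[seq gamD D | D in A]>>%VS.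

Lemma mem_gam_span A D : D \in A -> gamD D \in gam_span A.
Proof. by move=> DA; apply/memv_span/imageP; exists D. Qed.

Lemma gam_span_sub A (V : {vspace 'KS[K]_n}) :
  (forall D, D \in A -> gamD D \in V) -> (gam_span A <= V)%VS.
Proof. by move=> AV; apply/span_subvP => _ /imageP[D /AV DV ->]. Qed.

Lemma gamD_descent D : gamD D \in descent_alg K n.
Proof.
by apply: gam_descent; [exact: lie_series_descent | exact: setw_gt0 | exact: sumn_setw].
Qed.

Lemma gam_wset (q : seq nat) : 0%N \notin q -> sumn q = n -> gam g n q = gamD (wset n q).
Proof. by move=> q0 sq; rewrite /gamD setw_wset. Qed.

Lemma gamD_expand D : exists c : {set 'I_n.-1} -> K,
  [/\ c D != 0, forall F, c F != 0 -> D \subset F & gamD D = \sum_F c F *: Xi K F].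
Proof.
exists (fun F => Xi_coord F (gamD D)).
have [tri diag] := gam_triangular charK g_lie (setw_gt0 D) (sumn_setw D).
split; last exact: Xi_expand (gamD_descent D).
  by rewrite -[D in Xi_coord D _]setwK.
by move=> F /tri; rewrite setwK.
Qed.

(** The triangular system is solved by induction on the size of the complement of [D]. *)
Lemma gam_spanT : gam_span setT = descent_alg K n.
Proof.
apply/eqP; rewrite eqEsubv; apply/andP; split.
  by apply: gam_span_sub => D _; apply: gamD_descent.
rewrite descent_alg_Xi; apply/span_subvP => _ /mapP[i _ ->].
move: (enum_val i) => D {i}; have [m] := ubnP #|~: D|; elim: m D => // m IHm D Dm.
have [c [cD cF defG]] := gamD_expand D.
have -> : Xi K D = (c D)^-1 *: (gamD D - \sum_(F | F != D) c F *: Xi K F).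
  by rewrite defG (bigD1 D) //= addrK scalerA mulVf // scale1r.
apply/memvZ/memvB; first exact/mem_gam_span/in_setT.
apply: memv_suml => F FD; have [->|/cF DF] := eqVneq (c F) 0; first by rewrite scale0r mem0v.
apply/memvZ/IHm; rewrite ltnS in Dm; apply: leq_trans Dm; apply: proper_card.
by rewrite properEneq (inj_eq (@setC_inj _)) FD setCS.
Qed.

(** The full family spans a space whose dimension is the number of its members; subfamilies inherit
    freeness. *)
Lemma gam_free A : free [seq gamD D | D in A].
Proof.
have freeT : free [seq gamD D | D in [set: {set 'I_n.-1}]].
  by rewrite /free -/(gam_span setT) gam_spanT dim_descent_alg size_image cardsT.
apply: (@catl_free _ _ [seq gamD D | D in ~: A]).
rewrite /image_mem -map_cat (perm_free (Y := [seq gamD D | D in setT])) //.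
apply/perm_map/uniq_perm; rewrite ?enum_uniq //.
  rewrite cat_uniq !enum_uniq andbT; apply/hasPn => D.
  by rewrite !mem_enum inE.
by move=> D; rewrite mem_cat !mem_enum !inE; case: (D \in A).
Qed.

Lemma dim_gam_span A : \dim (gam_span A) = #|A|.
Proof. by have /eqP := gam_free A; rewrite size_image. Qed.

Definition rearrangements p : {set {set 'I_n.-1}} := [set D | perm_eq (setw D) (parts p)].

Lemma parts_neq0 p : 0%N \notin parts p.
Proof. by have /and3P[] := valP p. Qed.

Lemma parts_inj : injective (@parts n).
Proof. by move=> p p' /(inj_map val_inj) /val_inj/val_inj. Qed.

Lemma rearrangements_cover D : exists p, D \in rearrangements p.
Proof.
have [|p pE] := @in_partition_of n (sort geq (setw D)).
  apply/and3P; split; first by apply: sort_sorted => x y; apply: leq_total.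
    by rewrite mem_sort setw_gt0.
  by rewrite -[X in _ == X](sumn_setw D) !sumnE; apply/eqP/perm_big; rewrite perm_sort.
by exists p; rewrite inE pE perm_sym perm_sort.
Qed.

Lemma rearrangements_inj D p p' :
  D \in rearrangements p -> D \in rearrangements p' -> p = p'.
Proof.
rewrite !inE => Dp Dp'; apply/parts_inj/(@sorted_eq _ geq).
- by move=> x y z yx xz; apply: leq_trans xz yx.
- by move=> x y; rewrite andbC => /anti_leq.
- by have /and3P[] := valP p.
- by have /and3P[] := valP p'.
by rewrite -(permPl Dp).
Qed.

Lemma wset_rearrangements p (q : seq nat) : perm_eq q (parts p) ->
  [/\ 0%N \notin q, sumn q = n & wset n q \in rearrangements p].
Proof.
move=> qp; have q0 : 0%N \notin q by rewrite (perm_mem qp) parts_neq0.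
have sq : sumn q = n by rewrite -(sumn_parts p) !sumnE; apply: perm_big.
by rewrite inE setw_wset.
Qed.

Lemma parts_rearrangements p : wset n (parts p) \in rearrangements p.
Proof. by have [] := wset_rearrangements (perm_refl (parts p)). Qed.

Lemma gamD_mul p (f : 'KS[K]_n) D : f \in descent_alg K n -> D \in rearrangements p ->
  f * gamD D \in gam_span (rearrangements p).
Proof.
move=> /Xi_expand-> Dp; rewrite mulr_suml; apply: memv_suml => F _.
rewrite -scalerAl; apply: memvZ; rewrite -(setwK F).
have [s [sD ->]] := mulXi_gam_span g_lief (setw_gt0 D) (sumn_setw D) (sumn_setw F).
elim: s sD => [|v s IHs] /=; first by rewrite big_nil mem0v.
case/andP=> Dv /IHs IH; rewrite big_cons memvD //.
have vp : perm_eq v (parts p) by rewrite -(permPl Dv); rewrite inE in Dp.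
have [v0 sv vP] := wset_rearrangements vp.
by rewrite gam_wset // mem_gam_span.
Qed.

Lemma Xi_mul_gamD p D E : D \in rearrangements p -> E \in rearrangements p ->
  exists2 a : K, a != 0 & Xi K D * gamD E = a *: gamD D.
Proof.
rewrite !inE => Dp Ep; have DE : perm_eq (setw D) (setw E) by rewrite (permPr Ep).
have [N N0] := mulXi_gam_perm g_lief (setw_gt0 E) (sumn_setw E) DE.
rewrite setwK => NE; exists N%:R; last exact: NE.
by rewrite ((pcharf0P K).1 charK) -lt0n.
Qed.

(** Expand [gamD D] into the [Xi K F] with [F] containing [D]. For larger [F] the composition is
    longer than that of [E], and [mulXi_gam0] applies; the term [F = D] gives a nonzero multiple of
    [gamD D]. *)
Lemma gamD_mul_gamD p D E : D \in rearrangements p -> E \in rearrangements p ->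
  exists2 a : K, a != 0 & gamD D * gamD E = a *: gamD D.
Proof.
move=> Dp Ep; have [a a0 DE] := Xi_mul_gamD Dp Ep.
have [c [cD cF defD]] := gamD_expand D; exists (c D * a); first exact: mulf_neq0.
rewrite {1}defD mulr_suml (bigD1 D) //= -scalerAl DE scalerA big1 ?addr0 // => F FD.
have [->|/cF DF] := eqVneq (c F) 0; first by rewrite scale0r mul0r.
rewrite -scalerAl -(setwK F) mulXi_gam0 ?scaler0 ?setw_gt0 ?sumn_setw //.
have /perm_size-> : perm_eq (setw E) (setw D).
  by move: Dp Ep; rewrite !inE => Dp Ep; rewrite (permPr Dp).
by rewrite !size_setw // ltnS; apply: proper_card; rewrite properEneq eq_sym FD.
Qed.

Lemma Lambda_gam_span p : Lambda g p = gam_span (rearrangements p).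
Proof.
have [pP0 sP _] := wset_rearrangements (perm_refl (parts p)).
have outE : outer_partition g p = gamD (wset n (parts p)).
  by rewrite outer_partition_gam ?gam_wset //; apply: lie_series_descent.
rewrite /Lambda outE; apply/eqP; rewrite eqEsubv; apply/andP; split.
  apply/subvP => _ /memv_imgP[f fD ->]; rewrite lfunE /=.
  exact: gamD_mul fD (parts_rearrangements p).
apply: gam_span_sub => D Dp; have [a a0 eqa] := Xi_mul_gamD Dp (parts_rearrangements p).
have -> : gamD D = a^-1 *: (Xi K D * gamD (wset n (parts p))).
  by rewrite eqa scalerA mulVf // scale1r.
apply/memvZ/memv_imgP; exists (Xi K D); first exact: Xi_descent.
by rewrite lfunE.
Qed.

Lemma Lambda_left_module p : left_module (descent_alg K n) (Lambda g p).
Proof.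
rewrite Lambda_gam_span; apply/prodvP => f x fD /coord_span->.
rewrite mulr_sumr; apply: memv_suml => i _; rewrite -scalerAr; apply: memvZ.
rewrite -tnth_nth.
have /mapP[D + ->] := mem_tnth i (image_tuple gamD (rearrangements p)).
by rewrite mem_enum; apply: gamD_mul.
Qed.

(** The hypothesis makes [A] the union of the rearrangement classes selected by [P]. It is used for
    the odd partitions, for the others, and for all of them. *)
Lemma sum_Lambda (P : pred (partition_of n)) A :
    (forall p D, D \in rearrangements p -> (D \in A) = P p) ->
  (\sum_(p | P p) Lambda g p)%VS = gam_span A.
Proof.
move=> AP; apply/eqP; rewrite eqEsubv; apply/andP; split.
  apply/subv_sumP => p Pp; rewrite Lambda_gam_span; apply: gam_span_sub => D Dp.
  by apply: mem_gam_span; rewrite (AP p).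
apply: gam_span_sub => D DA; have [p Dp] := rearrangements_cover D.
have Pp : P p by rewrite -(AP p D).
by apply: (subvP (sumv_sup p Pp (subvv _))); rewrite Lambda_gam_span mem_gam_span.
Qed.

Lemma sum_dim_Lambda (P : pred (partition_of n)) A :
    (forall p D, D \in rearrangements p -> (D \in A) = P p) ->
  (\sum_(p | P p) \dim (Lambda g p) = #|A|)%N.
Proof.
move=> AP; under eq_bigr do rewrite Lambda_gam_span dim_gam_span.
under eq_bigr do rewrite -sum1_card.
rewrite (exchange_big_dep (fun D => D \in A)) /= => [|p D Pp Dp]; last by rewrite (AP p).
rewrite -sum1_card; apply: eq_bigr => D DA; have [p Dp] := rearrangements_cover D.
rewrite (big_pred1 p) // => p'; apply/andP/eqP => [[_ Dp']|->].
  exact: rearrangements_inj Dp' Dp.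
by rewrite -(AP p D).
Qed.

Lemma directv_Lambda (P : pred (partition_of n)) A :
    (forall p D, D \in rearrangements p -> (D \in A) = P p) ->
  directv (\sum_(p | P p) Lambda g p).
Proof.
by move=> AP; rewrite directvE /= (sum_Lambda AP) dim_gam_span (sum_dim_Lambda AP).
Qed.

Lemma odd_rearrangements p D : D \in rearrangements p -> (D \in odd_set n) = odd_partition p.
Proof. by rewrite !inE => /perm_all->. Qed.

(** The span on the right lies in the peak algebra, and its dimension is at least as large by
    [dim_peak_alg]. *)
Lemma peak_alg_gam_span : (forall m, odd m -> g m \in peak_alg K m) ->
  peak_alg K n = gam_span (odd_set n).
Proof.
move=> gP; apply/esym/eqP; rewrite eqEdim dim_gam_span dim_peak_alg // andbT.
apply: gam_span_sub => D; rewrite inE => oD; apply: gam_peak => //.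
  exact: lie_series_descent.
exact: sumn_setw.
Qed.

(** Left multiplication by e = g_p maps [M] into the line of e, and e * e is not 0. So for e = u + v
    one of e * u and e * v is a nonzero multiple of e, and the corresponding summand contains e. It
    then contains every [gamD D = a^-1 *: (gamD D * e)], hence all of [M]. As [p] is odd, all these
    multipliers lie in the peak algebra, so no identity is required. *)
Lemma indecomposable_Lambda p : (forall m, odd m -> g m \in peak_alg K m) ->
  odd_partition p -> indecomposable (peak_alg K n) (Lambda g p).
Proof.
move=> gP op; rewrite Lambda_gam_span; set M := gam_span _.
have gamP D : D \in rearrangements p -> gamD D \in peak_alg K n.
  by move=> Dp; rewrite (peak_alg_gam_span gP) mem_gam_span ?(odd_rearrangements Dp).
set e := gamD (wset n (parts p)); have pp := parts_rearrangements p.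
split.
  by move/(congr1 (@dimv _ _)); rewrite dim_gam_span dimv0 => /cards0_eq r0; rewrite r0 inE in pp.
have eM : e \in M by apply: mem_gam_span.
have e_line x : x \in M -> e * x \in <[e]>%VS.
  move=> /coord_span->; rewrite mulr_sumr; apply: memv_suml => i _.
  rewrite -scalerAr -tnth_nth; apply: memvZ.
  have /mapP[D + ->] := mem_tnth i (image_tuple gamD (rearrangements p)).
  rewrite mem_enum => Dp; have [a _ ->] := gamD_mul_gamD pp Dp.
  exact/memvZ/memv_line.
have full W w : left_module (peak_alg K n) W -> (W <= M)%VS -> w \in W -> e * w != 0 ->
    (M <= W)%VS.
  move=> modW WM wW ew0; have eW : e \in W.
    have /vlineP[a ewE] := e_line w (subvP WM w wW).
    have a0 : a != 0 by apply: contra_neq ew0 => a0; rewrite ewE a0 scale0r.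
    have -> : e = a^-1 *: (e * w) by rewrite ewE scalerA mulVf // scale1r.
    by apply/memvZ/(subvP modW)/memv_mul => //; apply: gamP.
  apply: gam_span_sub => D Dp; have [a a0 Dea] := gamD_mul_gamD Dp pp.
  have -> : gamD D = a^-1 *: (gamD D * e) by rewrite Dea scalerA mulVf // scale1r.
  by apply/memvZ/(subvP modW)/memv_mul => //; apply: gamP.
move=> U V modU modV /directv_addP UV0 UVM.
have UM : (U <= M)%VS by rewrite -UVM addvSl.
have VM : (V <= M)%VS by rewrite -UVM addvSr.
have /memv_addP[u uU [v vV e_uv]] : e \in (U + V)%VS by rewrite UVM.
have [eu0|eu] := eqVneq (e * u) 0; last first.
  by right; rewrite -UV0; apply/esym/capv_idPr/(subv_trans VM)/(full U u).
left; rewrite -UV0; apply/esym/capv_idPl/(subv_trans UM)/(full V v) => //.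
have [a a0 eeE] := gamD_mul_gamD pp pp.
have <- : e * e = e * v by rewrite {2}e_uv mulrDr eu0 add0r.
rewrite eeE scaler_eq0 negb_or a0.
by apply: free_not0 (gam_free (rearrangements p)) _; apply/imageP; exists (wset n (parts p)).
Qed.

End Decomposition.

Theorem theorem10 (K : fieldType) (charK : [pchar K] =i pred0)
    (n : nat) (n_gt0 : (0 < n)%N)
    (g : forall m : nat, 'KS[K]_m) (g_lie : lie_series g)
    (g_peak : forall m : nat, odd m -> g m \in peak_alg K m) :
  (* the decomposition of the peak algebra into indecomposable left modules
     over itself *)
  [/\ directv (\sum_(p : partition_of n | odd_partition p) Lambda g p),
      peak_alg K n =
        (\sum_(p : partition_of n | odd_partition p) Lambda g p)%VS
    & forall p : partition_of n, odd_partition p ->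
        left_module (peak_alg K n) (Lambda g p) /\
        indecomposable (peak_alg K n) (Lambda g p)]
  /\
  (* the decompositions of the regular left module of the descent algebra *)
  [/\ left_module (descent_alg K n) (peak_alg K n),
      forall p : partition_of n, left_module (descent_alg K n) (Lambda g p),
      directv (\sum_(p : partition_of n) Lambda g p) /\
      descent_alg K n = (\sum_(p : partition_of n) Lambda g p)%VS
    & directv (peak_alg K n +
               \sum_(p : partition_of n | ~~ odd_partition p) Lambda g p) /\
      descent_alg K n =
        (peak_alg K n +
         \sum_(p : partition_of n | ~~ odd_partition p) Lambda g p)%VS].
Proof.
have modL := @Lambda_left_module K g charK g_lie n.
have oddP := @odd_rearrangements n.
have evenP (p : partition_of n) D : D \in rearrangements p ->
    (D \in ~: odd_set n) = ~~ odd_partition p by move=> Dp; rewrite inE (oddP _ _ Dp).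
have anyP (p : partition_of n) D : D \in rearrangements p -> (D \in setT) = true.
  by rewrite in_setT.
have peakE : peak_alg K n = (\sum_(p : partition_of n | odd_partition p) Lambda g p)%VS.
  by rewrite (sum_Lambda charK g_lie oddP); apply: peak_alg_gam_span.
have descE : descent_alg K n = (\sum_(p : partition_of n) Lambda g p)%VS.
  by rewrite (sum_Lambda charK g_lie anyP) gam_spanT.
have descE2 : descent_alg K n = (peak_alg K n +
    \sum_(p : partition_of n | ~~ odd_partition p) Lambda g p)%VS.
  by rewrite descE (bigID (@odd_partition n)) /= -peakE.
split; split=> //.
- exact: directv_Lambda oddP.
- move=> p op; split; last exact: indecomposable_Lambda.
  by apply: subv_trans (modL p); apply/prodvSl/peak_sub_descent.
(* The peak algebra is a left ideal because it is a sum of the left ideals Lambda^p. *)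
- apply/prodvP => f x fD; rewrite peakE => /memv_sumP[v vL ->]; rewrite mulr_sumr.
  by apply: memv_sumr => p op; apply/(subvP (modL p))/memv_mul; rewrite ?vL.
- by split=> //; apply: directv_Lambda anyP.
(* Directness by dimensions: the odd compositions and their complement together count all
   compositions. *)
split=> //; rewrite directvE /= -descE2 (sum_dim_Lambda charK g_lie evenP).
by rewrite dim_descent_alg (peak_alg_gam_span charK g_lie n_gt0 g_peak)
  (dim_gam_span charK g_lie) cardsC.
Qed.
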